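(* Let $\beta>1$ and $h=0$. Let $\Sigma=(\sigma_1,\ldots,\sigma_n)\in\{-1,1\}^n$ have the Curie--Weiss distribution with inverse temperature $\beta$ and external field $h=0$, and let $S=\sum_{i=1}^n\sigma_i$. Let $m_1<0<m_2$ (with $m_1=-m_2$) be the two nonzero solutions of $m=\tanh(\beta m)$. Define $$W_1=\frac{S-nm_1}{\sigma_{(1)}},\quad W_2=\frac{S-nm_2}{\sigma_{(2)}},\quad \sigma_{(1)}^2=\frac{n(1-m_1^2)}{1-(1-m_1^2)\beta},\quad \sigma_{(2)}^2=\frac{n(1-m_2^2)}{1-(1-m_2^2)\beta}.$$ Then $$\frac{P(W_1\ge x\mid S<0)}{1-\Phi(x)}=1+O(1)(1+x^3)/\sqrt n$$ and $$\frac{P(W_2\ge x\mid S>0)}{1-\Phi(x)}=1+O(1)(1+x^3)/\sqrt n$$ for $0\le x\le n^{1/6}$.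
   Context: $\Phi$ is the standard normal distribution function. The Curie--Weiss distribution of $n$ spins $(\sigma_1,\ldots,\sigma_n)\in\{-1,1\}^n$ with inverse temperature $\beta$ and external field $h$ assigns to each configuration the probability $$Z_{\beta,h}^{-1}\exp\Bigl(\frac\beta n\sum_{1\le i<j\le n}\sigma_i\sigma_j+\beta h\sum_{i=1}^n\sigma_i\Bigr),$$ where $Z_{\beta,h}$ is the normalizing constant. For $\beta>1$, $h=0$ one has $1-(1-m_i^2)\beta>0$ for $i=1,2$, so $\sigma_{(1)},\sigma_{(2)}>0$ are well defined. $O(1)$ denotes a quantity whose absolute value is bounded by a constant not depending on $n$ and $x$ (it may depend on $\beta$). *)

(* Defs.v *)
From HB Require Import structures.
From mathcomp Require Import all_boot all_order all_algebra.
From mathcomp Require Import all_classical all_reals all_analysis.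

Set Implicit Arguments.
Unset Strict Implicit.
Unset Printing Implicit Defensive.

Import Order.TTheory GRing.Theory Num.Theory.
Import numFieldNormedType.Exports.

Local Open Scope classical_set_scope.
Local Open Scope ring_scope.

Definition tanh (R : realType) (x : R) : R :=
  (expR x - expR (- x)) / (expR x + expR (- x)).

Definition std_normal_cdf (R : realType) (x : R) : R :=
  fine (normal_prob 0 1 `]-oo, x]).

(* Only meaningful when [P B] is nonzero; it is 0 otherwise. *)
Definition cond_prob (d : measure_display) (T : measurableType d)
    (R : realType) (P : probability T R) (A B : set T) : R :=
  fine (P (A `&` B)) / fine (P B).

(* Configurations in {-1,1}^n are encoded by Boolean functions on 'I_n. *)
Definition spin (R : realType) (b : bool) : R := if b then 1 else -1.

Definition curie_weiss_weight (R : realType) (beta h : R) (n : nat)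
    (s : {ffun 'I_n -> bool}) : R :=
  expR (beta / n%:R
          * (\sum_(i < n) \sum_(j < n | (i < j)%N) spin R (s i) * spin R (s j))
        + beta * h * \sum_(i < n) spin R (s i)).

Definition curie_weiss_Z (R : realType) (beta h : R) (n : nat) : R :=
  \sum_(s : {ffun 'I_n -> bool}) curie_weiss_weight beta h s.

Definition curie_weiss_pmf (R : realType) (beta h : R) (n : nat)
    (s : {ffun 'I_n -> bool}) : R :=
  (curie_weiss_Z beta h n)^-1 * curie_weiss_weight beta h s.

Definition curie_weiss_distributed (d : measure_display)
    (T : measurableType d) (R : realType) (P : probability T R)
    (beta h : R) (n : nat) (Sigma : 'I_n -> {RV P >-> R}) : Prop :=
  (forall i w, Sigma i w = 1 \/ Sigma i w = -1) /\
  (forall s : {ffun 'I_n -> bool},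
     P [set w | forall i, Sigma i w = spin R (s i)]
     = (curie_weiss_pmf beta h s)%:E).

Definition total_spin (d : measure_display) (T : measurableType d)
    (R : realType) (P : probability T R) (n : nat)
    (Sigma : 'I_n -> {RV P >-> R}) (w : T) : R :=
  \sum_(i < n) Sigma i w.

(* sigma_(i) is the case m = m_i; for these roots (1 - m^2) beta < 1. *)
Definition cw_sigma (R : realType) (beta : R) (n : nat) (m : R) : R :=
  Num.sqrt (n%:R * (1 - m ^+ 2) / (1 - (1 - m ^+ 2) * beta)).

Definition cw_W (d : measure_display) (T : measurableType d)
    (R : realType) (P : probability T R) (beta : R) (n : nat)
    (Sigma : 'I_n -> {RV P >-> R}) (m : R) (w : T) : R :=
  (total_spin Sigma w - n%:R * m) / cw_sigma beta n m.

(* Main.v *)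
Require Import Defs.
From HB Require Import structures.
From mathcomp Require Import all_boot all_order all_algebra.
From mathcomp Require Import all_classical all_reals all_analysis.
From mathcomp Require Import measurable_realfun.
From mathcomp Require Import ring lra zify.
Import Order.TTheory GRing.Theory Num.Theory.
Import numFieldNormedType.Exports.
Local Open Scope classical_set_scope.
Local Open Scope ring_scope.

(** Everything is conditional on the sign of [S], so the partition function
    cancels: if [a_k = 'C(n, k) * exp (beta / (2 n) * (2 k - n) ^ 2)] is the weight
    of the value [2 k - n] of [S], both claims compare partial sums of the [a_k]
    with [n < 2 k] to the sum of all of them. The symmetry [k |-> n - k] carries
    the negative phase, centred at [m1], to the positive phase centred at
    [- m1], which is again a positive root of the mean-field equation. So it
    suffices to treat one positive root [m], and to find both the right tail and
    the left tail of the positive phase around [n * m].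

    No asymptotics of factorials are needed, because only ratios of the [a_k]
    matter. Let [y] be the magnetization halfway between [k] and [k + 1]. Then
    [ln (a_(k+1) / a_k)] is
    [ln ((1 - y + 1/n) / (1 + y + 1/n)) + 2 beta y], which vanishes at [y = m] up to
    [1/n] since [m = tanh (beta m)], and whose slope there is [- 2 gamma] with
    [gamma = 1 / (1 - m ^ 2) - beta > 0]. In the coordinate
    [u_k = (2 k - n - n m) / sigma], where [sigma ^ 2 = n / gamma], the linear term
    is exactly the increment of [- u ^ 2 / 2]. Summing the errors from the
    centre gives [a_k = A * phi (u_k) * exp (O ((1 + |u_k| ^ 3) / sqrt n))]
    as long as [|u_k| <= 3 n ^ (1/6)], with the same [A] on both sides of the centre
    ([level_close], [right_tail], [left_tail]).

    It remains to sum a Gaussian with such relative errors over a lattice of step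
    [2 / sigma] ([riemann_tail]). The function
    [G u + s * (G u + (u ^ 2 + 2) * phi u)], with [G = 1 - Phi], has derivative
    [- phi u * (1 + s * (1 + u ^ 3))], so for [s = c / sqrt n] and
    [s = - c / sqrt n] its differences over the steps of the lattice bound the terms
    from above and from below, and the sums telescope. Mills' ratio
    turns the value of this function at [x] into
    [G x * (1 + O ((1 + x ^ 3) / sqrt n))]. Sites beyond
    [3 n ^ (1/6)] are at most [n + 1] in number, and each weighs no more than a
    site between [2 n ^ (1/6)] and [3 n ^ (1/6)], because the [a_k] decrease away
    from the centre; this monotonicity propagates over the whole phase since
    [tanh t / t] is decreasing. Their total is negligible against [A * G x] for
    [x <= n ^ (1/6)].

    Finally [x = 0] gives the mass of the whole phase, [A * sigma / 2] up to a factor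
    [1 + O (1 / sqrt n)], because the two halves contribute [G 0 = 1/2]
    each ([tail_weights]); the quotient gives the claim for large [n]. For bounded
    [n] the quotient is bounded and the error term is bounded below
    ([root_tails]). *)

(** * The Gaussian tail *)

Definition gauss_tail {R : realType} (x : R) : R := 1 - std_normal_cdf x.

Section GaussianTail.
Context {R : realType}.
Implicit Types x y z : R.

Local Notation phi := (@normal_pdf R 0 1).
Local Notation G := (@gauss_tail R).

Lemma std_normal_pdfE x : phi x = normal_peak 1 * expR (- (x ^+ 2 / 2)).
Proof.
rewrite normal_pdfE ?oner_neq0//= /normal_fun subr0; congr (_ * expR _).
by rewrite expr1n mulNr.
Qed.

Lemma std_normal_pdf_gt0 x : 0 < phi x.
Proof.
by rewrite std_normal_pdfE mulr_gt0 ?expR_gt0// normal_peak_gt0// oner_neq0.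
Qed.

Lemma std_normal_pdf_le x y : 0 <= x -> x <= y -> phi y <= phi x.
Proof.
move=> x0 xy; rewrite !std_normal_pdfE ler_pM2l ?normal_peak_gt0 ?oner_neq0//.
rewrite ler_expR lerN2 ler_pM2r ?invr_gt0 ?ltr0n// lerXn2r ?nnegrE//.
exact: le_trans xy.
Qed.

Lemma is_derive_std_normal_pdf x : is_derive x 1 phi (- (x * phi x)).
Proof.
have -> : phi = fun x => normal_peak 1 * expR (- (x ^+ 2 / 2)).
  by apply/funext => y; exact: std_normal_pdfE.
apply: is_derive_eq.
rewrite /GRing.scale/=; lra.
Qed.

Lemma is_derive_std_normal_cdf x :
  is_derive x 1 (@std_normal_cdf R) (phi x).
Proof.
have intphi : lebesgue_measure.-integrable `]-oo, x + 1] (EFin \o phi).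
  apply: (@integrableS _ _ _ _ setT) => //; exact: integrable_normal_pdf.
have xx : x < x + 1 by rewrite ltrDl.
have [] := continuous_FTC1 xx intphi (ltNyr _)
  (@continuous_normal_pdf _ 0 1 (oner_neq0 _) x).
by move=> df <-; rewrite derive1E; apply: DeriveDef.
Qed.

Lemma is_derive_gauss_tail x : is_derive x 1 G (- phi x).
Proof.
have := is_derive_std_normal_cdf x => ?.
rewrite /gauss_tail; apply: is_derive_eq; lra.
Qed.

Lemma gauss_tail_ge0 x : 0 <= G x.
Proof.
rewrite subr_ge0 /std_normal_cdf -[leRHS]/(fine 1%:E) fine_le//.
  by rewrite fin_num_measure.
exact: probability_le1.
Qed.

Lemma cvg_gauss_tail : G z @[z --> +oo] --> (0 : R).
Proof.
(* [G] is the complement of the distribution function of the identity. *)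
pose X : measurableTypeR R -> R := idfun.
pose mX := @isMeasurableFun.Build _ _ _ _ X (@measurable_id _ _ setT).
pose X' : {RV (normal_prob 0 1 : probability _ R) >-> R} := HB.pack X mX.
have /= := cvg_cdfy1 X'.
rewrite /cdf /distribution /pushforward/=.
move=> /fine_cvg /= h.
rewrite -[0](subrr 1); apply: cvgB; first exact: cvg_cst.
exact: h.
Qed.

Lemma gauss_tail0 : G 0 = 2^-1.
Proof.
have := @ge0_symfun_integralT R phi (normal_pdf_ge0 _ _)
  (@continuous_normal_pdf _ 0 1 (oner_neq0 _)).
rewrite integral_normal_pdf -set_itvcy -integral_itv_obnd_cbnd; last first.
  by apply/measurable_EFinP; apply: measurable_funTS; exact: measurable_normal_pdf.
have phi_even : phi =1 phi \o -%R by move=> x; rewrite /= !std_normal_pdfE sqrrN.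
move=> /(_ phi_even).
have -> : `]0, +oo[%classic = ~` `]-oo, (0 : R)]%classic by rewrite setCitvl.
rewrite -[X in (_ * X)%E]/(normal_prob 0 1 _) probability_setC//.
rewrite /gauss_tail /std_normal_cdf.
have := fin_num_measure (normal_prob 0 1) `]-oo, (0:R)]%classic.
move=> /(_ (measurable_itv _)) /fineK <-.
rewrite -EFinB -EFinM => -[]; rewrite /=; lra.
Qed.

Lemma gauss_tail_decr y z : 0 <= y -> y <= z ->
  (z - y) * phi z <= G y - G z <= (z - y) * phi y.
Proof.
move=> y0 yz.
have [||c cyz e] := @MVT_segment R G (fun x => - phi x) y z yz.
- by move=> x _; exact: is_derive_gauss_tail.
- apply: derivable_within_continuous => x _.
  by have := is_derive_gauss_tail x => -[].
have -> : G y - G z = (z - y) * phi c by lra.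
move: cyz; rewrite in_itv/= => /andP[yc cz].
by rewrite !ler_wpM2l ?subr_ge0 ?std_normal_pdf_le// (le_trans y0).
Qed.

Lemma gauss_tail_nincr y z : 0 <= y -> y <= z -> G z <= G y.
Proof.
move=> y0 yz; have /andP[+ _] := gauss_tail_decr y z y0 yz.
have : 0 <= (z - y) * phi z by rewrite mulr_ge0 ?subr_ge0// ltW// std_normal_pdf_gt0.
lra.
Qed.

(** Only the tail beyond [x + 1 / (1 + x)] is discarded, and on the interval
    that is kept the density drops by a bounded factor. *)
Lemma mills_lower x : 0 <= x -> phi x <= 8 * ((1 + x) * G x).
Proof.
move=> x0; pose h := (1 + x)^-1.
have x1 : 0 < 1 + x by lra.
have h0 : 0 < h by rewrite invr_gt0.
have hx : h * (1 + x) = 1 by rewrite mulVf// gt_eqF.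
have hle1 : h <= 1 by nra.
have /andP[+ _] := gauss_tail_decr x (x + h) x0 ltac:(lra).
have := gauss_tail_ge0 (x + h).
have phih : phi x <= 8 * phi (x + h).
  rewrite !std_normal_pdfE mulrCA ler_pM2l ?normal_peak_gt0 ?oner_neq0//.
  have -> : - (x ^+ 2 / 2) = (x * h + h ^+ 2 / 2) - (x + h) ^+ 2 / 2 by field.
  rewrite expRD ler_wpM2r ?expR_ge0//.
  (* The drop is at most [exp (3/2)], and [1/2 <= ln 2]. *)
  have -> : 8 = (expR (ln 2)) ^+ 3 :> R by rewrite lnK ?posrE//; lra.
  rewrite -expRM_natr ler_expR.
  have : 2^-1 <= ln 2 :> R.
    rewrite -ler_expR lnK ?posrE// -[leRHS]invrK -[leLHS]invrK -expRN.
    rewrite lef_pV2 ?posrE ?expR_gt0 ?invr_gt0//.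
    by have := @expR_ge1Dx R (- 2^-1); lra.
  nra.
rewrite addrAC subrr add0r => G0 Gh.
have : h * phi x <= 8 * G x by nra.
move=> /(ler_wpM2l (ltW x1)).
have -> : (1 + x) * (h * phi x) = phi x by rewrite mulrA (mulrC _ h) hx mul1r.
lra.
Qed.

Lemma gauss_tail_gt0 x : 0 <= x -> 0 < gauss_tail x.
Proof.
move=> x0; have := mills_lower x x0; have := std_normal_pdf_gt0 x.
have := gauss_tail_ge0 x.
rewrite le_eqVlt => /orP[/eqP<-|//]; rewrite !mulr0; lra.
Qed.

(** Beyond [1] the density is at most [x * phi x], the slope of [- phi]. *)
Lemma mills_upper y : 1 <= y -> G y <= phi y.
Proof.
move=> y1; have cG : G y - G z @[z --> +oo] --> G y.
  rewrite -[X in _ --> X]subr0.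
  by apply: cvgB; [exact: cvg_cst|exact: cvg_gauss_tail].
apply: (cvgr_to_le cG).
near=> z.
have yz : y <= z by near: z; exact: nbhs_pinfty_ge (num_real y).
have dF x : is_derive x 1 (fun x => G x - phi x) (- phi x + x * phi x).
  have := is_derive_gauss_tail x => ?.
  have := is_derive_std_normal_pdf x => ?.
  by apply: is_derive_eq; rewrite opprK.
have [|c cyz e] := @MVT_segment R (fun x => G x - phi x)
    (fun x => - phi x + x * phi x) y z yz.
  by apply: derivable_within_continuous => x _; have := dF x => -[].
move: cyz e; rewrite in_itv/= => /andP[yc cz] e.
have : 0 <= (c - 1) * phi c * (z - y).
  by rewrite !mulr_ge0 ?subr_ge0// ?(le_trans y1)// ltW// std_normal_pdf_gt0.
have := std_normal_pdf_gt0 z; lra.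
Unshelve. all: by end_near. Qed.

(** The weight [1 + s * (1 + u ^+ 3)] is the shape of the relative errors to be
    integrated against [phi], with [s] of order [n ^ (-1/2)]; an antiderivative of
    [u ^+ 3 * phi u] is [- (u ^+ 2 + 2) * phi u]. *)
Definition corrected_tail (s u : R) : R := G u + s * (G u + (u ^+ 2 + 2) * phi u).

Lemma corrected_tailB s y z : y <= z ->
  exists2 c, y <= c <= z &
    corrected_tail s y - corrected_tail s z =
    (z - y) * (phi c * (1 + s * (1 + c ^+ 3))).
Proof.
move=> yz.
have dF x : is_derive x 1 (corrected_tail s) (- (phi x * (1 + s * (1 + x ^+ 3)))).
  have := is_derive_gauss_tail x => ?.
  have := is_derive_std_normal_pdf x => ?.
  rewrite /corrected_tail; apply: is_derive_eq.
  rewrite /GRing.scale/=; ring.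
have [|c cyz e] := @MVT_segment R (corrected_tail s)
    (fun x => - (phi x * (1 + s * (1 + x ^+ 3)))) y z yz.
  by apply: derivable_within_continuous => x _; have := dF x => -[].
by exists c; [move: cyz; rewrite in_itv | lra].
Qed.

(** The factor [exp (- 3/2 * a ^+ 2)] between [phi a] and [phi (2 * a)] beats any
    power of [a]. The ninth power pays for [a ^+ 6 = n] sites and for a relative
    accuracy of [a ^- 3 = n ^ (-1/2)]. *)
Lemma far_tail_negligible (a x : R) : 1 <= a -> 0 <= x <= a ->
  a ^+ 9 * phi (2 * a) <= 256 * G x.
Proof.
move=> a1 /andP[x0 xa].
have := mills_lower a ltac:(lra).
have := gauss_tail_nincr x a x0 xa.
have := gauss_tail_ge0 x.
have -> : phi (2 * a) = phi a * expR (- (3 / 2 * a ^+ 2)).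
  rewrite !std_normal_pdfE -(mulrA (normal_peak 1)) -expRD.
  by congr (_ * expR _); field.
have y0 : 0 <= 3 / 2 * a ^+ 2 by nra.
have := expR_ge1Dxn 4 y0.
rewrite expRN; set E := expR _; set g := G x; set ga := G a; set p := phi a.
have -> : 5`!%:R = 120 :> R by [].
have -> : (3 / 2 * a ^+ 2) ^+ 5 = 243 / 32 * a ^+ 10 :> R by field.
move=> hE g0 gag pga.
have a10 : 1 <= a ^+ 10 by rewrite exprn_ege1.
have E0 : 0 < E by lra.
rewrite mulrA ler_pdivrMr//.
have a90 : 0 <= a ^+ 9 by rewrite exprn_ge0//; lra.
have p16 : p <= 16 * (a * g) by nra.
apply: le_trans (ler_wpM2l a90 p16) _.
have -> : a ^+ 9 * (16 * (a * g)) = 16 * (g * a ^+ 10) by ring.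
nra.
Qed.

End GaussianTail.

(** * Gaussian Riemann sums *)

Section RiemannTail.
Context {R : realType}.
Implicit Types x t : R.

Local Notation phi := (@normal_pdf R 0 1).
Local Notation G := (@gauss_tail R).

Lemma expR_le_linear (c t : R) : 0 <= t -> t <= c -> expR t <= 1 + expR c * t.
Proof.
move=> t0 tc; have Et : expR t <= expR c by rewrite ler_expR.
have : expR t * (1 - t) <= 1.
  rewrite -[leRHS](expRxMexpNx_1 t) ler_pM2l ?expR_gt0//.
  exact: expR_ge1Dx.
nra.
Qed.

(** Mills' ratio makes the correction relative to [G x]. *)
Lemma corrected_tail_bound x : 0 <= x ->
  G x + (x ^+ 2 + 2) * phi x <= 49 * (1 + x ^+ 3) * G x.
Proof.
move=> x0; have := mills_lower x x0; have := gauss_tail_ge0 x.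
set g := G x; set p := phi x => g0 pg.
have h1 : (x ^+ 2 + 2) * p <= (x ^+ 2 + 2) * (8 * ((1 + x) * g)).
  by rewrite ler_wpM2l//; nra.
have x3 : 0 <= x ^+ 3 by rewrite exprn_ge0.
have h2 : (x ^+ 2 + 2) * (1 + x) <= 6 * (1 + x ^+ 3) by nra.
have h3 : (x ^+ 2 + 2) * (8 * ((1 + x) * g)) <= 48 * (1 + x ^+ 3) * g.
  have -> : (x ^+ 2 + 2) * (8 * ((1 + x) * g)) = 8 * g * ((x ^+ 2 + 2) * (1 + x)).
    by ring.
  have -> : 48 * (1 + x ^+ 3) * g = 8 * g * (6 * (1 + x ^+ 3)) by ring.
  by rewrite ler_wpM2l//; lra.
nra.
Qed.

(** The first two summands come from the upper bound of the lattice sum, the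
    last three from the lower bound. *)
Definition riemann_constant (d C : R) : R :=
  245 * (expR (28 * C) * C) + 528 * (d * expR (28 * C))
  + (49 * C + 528 * d + 256).

(** Meant for [a = n ^ (1/6)], so that the denominator is [sqrt n]. *)
Definition rel_error (C a v : R) : R := C * (1 + v ^+ 3) / a ^+ 3.

Section Lattice.
Variables (d C a x dl A : R) (u w : nat -> R) (M : nat).
Local Notation err := (rel_error C a).
Hypotheses (dl0 : 0 < dl) (dld : dl * a ^+ 3 = d).
Hypotheses (C0 : 0 <= C) (a1 : 1 <= a) (da : d <= a).
Hypotheses (x0 : 0 <= x) (xa : x <= a) (A0 : 0 < A).
Hypothesis uS : forall j, u j.+1 = u j + dl.
Hypotheses (xu0 : x <= u 0) (u0x : u 0 <= x + dl).
Hypothesis w0 : forall j, 0 <= w j.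
(* The Gaussian shape is known up to [3 * a]; from [2 * a] on there is decrease. *)
Hypothesis w_near : forall j, (j < M)%N -> u j <= 3 * a ->
  A * (phi (u j) * expR (- err (u j))) <= w j <=
  A * (phi (u j) * expR (err (u j))).
Hypothesis w_decr : forall j, (j.+1 < M)%N -> 2 * a <= u j -> w j.+1 <= w j.
Hypothesis uM : 3 * a < u M.
Hypothesis M_le : M%:R <= 2 * a ^+ 6.

(* Makes the section hypotheses visible to [lra]. *)
Ltac ctx := have ? := a1; have ? := da; have ? := x0; have ? := xa;
  have ? := xu0; have ? := u0x; have ? := uM; have ? := dl0; have ? := C0;
  have ? := A0; have ? := M_le.

Let a3_gt0 : 0 < a ^+ 3.
Proof. ctx; by rewrite exprn_gt0//; lra. Qed.

Let d0 : 0 < d.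
Proof. by rewrite -dld mulr_gt0. Qed.

Let dl1 : dl <= 1.
Proof.
ctx.
rewrite -(ler_pM2r a3_gt0) dld mul1r (le_trans da)//.
by rewrite -[leLHS]expr1 ler_weXn2l.
Qed.

Let u_ge j : x <= u j.
Proof. by elim: j => // j /le_trans; apply; rewrite uS lerDl ltW. Qed.

Let u_ge0 j : 0 <= u j.
Proof. exact: le_trans (u_ge j). Qed.

Let err_ge0 v : 0 <= v -> 0 <= err v.
Proof.
ctx.
move=> v0; rewrite /rel_error divr_ge0 ?(ltW a3_gt0)//.
by rewrite mulr_ge0// addr_ge0// exprn_ge0.
Qed.

Let err_le v : 0 <= v <= 3 * a -> err v <= 28 * C.
Proof.
ctx.
move=> /andP[v0 va]; rewrite ler_pdivrMr//.
have : v ^+ 3 <= (3 * a) ^+ 3 by rewrite lerXn2r ?nnegrE//; lra.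
have : 1 <= a ^+ 3 by rewrite exprn_ege1.
have -> : (3 * a) ^+ 3 = 27 * a ^+ 3 by ring.
have -> : 28 * C * a ^+ 3 = C * (28 * a ^+ 3) by ring.
by move=> h1 h2; rewrite ler_wpM2l//; lra.
Qed.

Let E := expR (28 * C).

Let E1 : 1 <= E.
Proof. by rewrite -[leLHS]expR0 ler_expR mulr_ge0. Qed.

Ltac ctx ::= have ? := a1; have ? := da; have ? := x0; have ? := xa;
  have ? := xu0; have ? := u0x; have ? := uM; have ? := dl0; have ? := C0;
  have ? := A0; have ? := M_le; have ? := dl1; have ? := E1.

Let w_far j : (j < M)%N -> 2 * a <= u j -> w j <= A * (phi (2 * a) * E).
Proof.
ctx.
elim: j => [|j IH] jM uj.
  have uj3 : u 0 <= 3 * a by lra.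
  have /andP[_ /le_trans] := w_near _ jM uj3; apply.
  rewrite ler_pM2l// ler_pM ?expR_ge0 ?(ltW (std_normal_pdf_gt0 _))//.
    by rewrite std_normal_pdf_le//; lra.
  by rewrite ler_expR err_le// u_ge0.
have [uj3|uj3] := leP (u j.+1) (3 * a).
  have /andP[_ /le_trans] := w_near _ jM uj3; apply.
  rewrite ler_pM2l// ler_pM ?expR_ge0 ?(ltW (std_normal_pdf_gt0 _))//.
    by rewrite std_normal_pdf_le//; lra.
  by rewrite ler_expR err_le// u_ge0.
have uj2 : 2 * a <= u j by move: uj3; rewrite uS; lra.
exact: le_trans (w_decr _ jM uj2) (IH (ltnW jM) uj2).
Qed.

(* The factor [5] absorbs [1 + (c + 1) ^+ 3 <= 5 * (1 + c ^+ 3)], needed to compare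
   the error at a site with the error at a point [c] of the step before it. *)
Let s := 5 * (E * C) / a ^+ 3.

Let upper_step j : (j.+1 < M)%N ->
  dl * w j.+1 <= A * (corrected_tail s (u j) - corrected_tail s (u j.+1))
                 + A * (dl * (phi (2 * a) * E)).
Proof.
ctx.
move=> jM; have uu : u j <= u j.+1 by rewrite uS lerDl ltW.
have [c /andP[uc cu] ->] := corrected_tailB s _ _ uu.
have c0 : 0 <= c by exact: le_trans uc.
have s0 : 0 <= s by rewrite divr_ge0 ?mulr_ge0 ?(ltW a3_gt0)//; lra.
have -> : u j.+1 - u j = dl by rewrite uS; ring.
have phi0 v : 0 <= phi v by exact/ltW/std_normal_pdf_gt0.
have E0 : 0 <= E by lra.
have [uj3|uj3] := leP (u j.+1) (3 * a); last first.
  have uj2 : 2 * a <= u j.+1 by lra.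
  have h : dl * w j.+1 <= dl * (A * (phi (2 * a) * E)).
    by rewrite ler_wpM2l ?(ltW dl0)// w_far.
  rewrite (le_trans h)// mulrCA lerDr mulr_ge0 ?(ltW A0)//.
  rewrite mulr_ge0 ?(ltW dl0)// mulr_ge0// addr_ge0// mulr_ge0// addr_ge0//.
  by rewrite exprn_ge0.
have /andP[_ h] := w_near _ jM uj3.
have h1 : expR (err (u j.+1)) <= 1 + s * (1 + c ^+ 3).
  apply: le_trans (expR_le_linear (28 * C) _ (err_ge0 _ _) (err_le _ _)) _ => //.
    by rewrite u_ge0.
  rewrite lerD2l -/E.
  have -> : s * (1 + c ^+ 3) = (E * C) / a ^+ 3 * (5 * (1 + c ^+ 3)).
    by rewrite /s; ring.
  have -> : E * err (u j.+1) = (E * C) / a ^+ 3 * (1 + u j.+1 ^+ 3).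
    by rewrite /rel_error; ring.
  rewrite ler_wpM2l//.
    by rewrite divr_ge0 ?(ltW a3_gt0)// mulr_ge0.
  have uc1 : u j.+1 <= c + 1 by move: uc; rewrite uS; lra.
  have : u j.+1 ^+ 3 <= (c + 1) ^+ 3 by rewrite lerXn2r ?nnegrE//; lra.
  have : 0 <= (c - 1) ^+ 2 * (c + 1) by rewrite mulr_ge0 ?sqr_ge0//; lra.
  have : 0 <= c ^+ 3 by rewrite exprn_ge0.
  lra.
have h2 : w j.+1 <= A * (phi c * (1 + s * (1 + c ^+ 3))).
  apply: (le_trans h); rewrite ler_pM2l// ler_pM ?expR_ge0//.
  by rewrite std_normal_pdf_le.
have h3 : dl * w j.+1 <= dl * (A * (phi c * (1 + s * (1 + c ^+ 3)))).
  by rewrite ler_wpM2l ?(ltW dl0).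
apply: (le_trans h3); rewrite mulrCA lerDl.
by rewrite mulr_ge0 ?(ltW A0)// mulr_ge0 ?(ltW dl0)// mulr_ge0.
Qed.

Let upper_sum m : (m < M)%N ->
  dl * \sum_(j < m.+1) w j <=
  A * (dl * (phi x * E)) +
  A * (corrected_tail s (u 0) - corrected_tail s (u m)) +
  m%:R * (A * (dl * (phi (2 * a) * E))).
Proof.
ctx.
elim: m => [|m IH] mM.
  rewrite big_ord1 subrr mulr0 mul0r !addr0 mulrCA ler_pM2l//.
  have u03 : u 0 <= 3 * a by lra.
  have /andP[_ /le_trans] := w_near _ mM u03; apply.
  rewrite ler_pM2l// ler_pM ?expR_ge0 ?(ltW (std_normal_pdf_gt0 _))//.
    by rewrite std_normal_pdf_le.
  by rewrite ler_expR err_le// u_ge0.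
rewrite big_ord_recr mulrDr.
apply: le_trans (lerD (IH (ltnW mM)) (upper_step m mM)) _.
rewrite -natr1; lra.
Qed.

Let sm := - (C / a ^+ 3).

(** Where [1 - err] is negative, or beyond the window, [0 <= w j] suffices. *)
Let lower_step j : (j < M)%N ->
  A * (corrected_tail sm (u j) - corrected_tail sm (u j.+1))
   - A * (dl * phi (2 * a)) <= dl * w j.
Proof.
ctx.
move=> jM; have uu : u j <= u j.+1 by rewrite uS lerDl ltW.
have [c /andP[uc cu] ->] := corrected_tailB sm _ _ uu.
have c0 : 0 <= c by exact: le_trans uc.
have -> : u j.+1 - u j = dl by rewrite uS; ring.
have phi0 v : 0 <= phi v by exact/ltW/std_normal_pdf_gt0.
have smc v : 1 + sm * (1 + v ^+ 3) = 1 - err v by rewrite /sm /rel_error; ring.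
rewrite smc.
suff : A * (phi c * (1 - err c) - phi (2 * a)) <= w j.
  move=> /(ler_wpM2l (ltW dl0)); apply: le_trans; rewrite le_eqVlt.
  by apply/orP; left; apply/eqP; ring.
have errc : err (u j) <= err c.
  by rewrite /rel_error ler_pM2r ?invr_gt0// ler_wpM2l// lerD2l lerXn2r ?nnegrE.
have errc0 := err_ge0 _ c0.
have [uj3|uj3] := leP (u j) (3 * a); last first.
  rewrite (le_trans _ (w0 j))// pmulr_rle0// subr_le0.
  have : phi c <= phi (2 * a) by rewrite std_normal_pdf_le//; lra.
  by apply: le_trans; rewrite ler_piMr//; lra.
have [c1|c1] := leP (err c) 1; last first.
  rewrite (le_trans _ (w0 j))// pmulr_rle0// subr_le0 (le_trans _ (phi0 _))//.
  by rewrite pmulr_rle0 ?std_normal_pdf_gt0//; lra.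
have /andP[h _] := w_near _ jM uj3.
apply: le_trans h; rewrite ler_pM2l//.
have := phi0 (2 * a).
have : phi c * (1 - err c) <= phi (u j) * expR (- err (u j)); last by lra.
rewrite ler_pM//; first by lra.
  by rewrite std_normal_pdf_le.
by apply: le_trans (expR_ge1Dx _); lra.
Qed.

Let lower_sum m : (m <= M)%N ->
  A * (corrected_tail sm (u 0) - corrected_tail sm (u m))
   - m%:R * (A * (dl * phi (2 * a))) <= dl * \sum_(j < m) w j.
Proof.
ctx.
elim: m => [|m IH] mM.
  by rewrite big_ord0 subrr !mulr0 mul0r subr0.
rewrite big_ord_recr /= mulrDr.
have := IH (ltnW mM); have := lower_step m mM.
rewrite -natr1; lra.
Qed.

(** The lattice sum is squeezed between telescoping differences of
    [corrected_tail]; the sites beyond [3 * a] are at most [2 * a ^+ 6] in number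
    and each of them weighs at most a constant times [A * phi (2 * a)]. *)
Lemma riemann_tail :
  `|dl * \sum_(j < M) w j - A * G x| <=
  riemann_constant d C * ((1 + x ^+ 3) / a ^+ 3) * (A * G x).
Proof.
ctx.
have phi0 v : 0 <= phi v by exact/ltW/std_normal_pdf_gt0.
have G0 := gauss_tail_ge0 x.
have far : a ^+ 9 * phi (2 * a) <= 256 * G x.
  by apply: far_tail_negligible; rewrite ?x0.
have near_x : phi x <= 16 * (1 + x ^+ 3) * G x.
  have := mills_lower x x0.
  have x30 : 0 <= x ^+ 3 by rewrite exprn_ge0.
  have : (1 + x) * G x <= 2 * (1 + x ^+ 3) * G x by rewrite ler_wpM2r//; nra.
  lra.
have bnd := corrected_tail_bound x x0.
pose q := (a ^+ 3)^-1.
have q0 : 0 < q by rewrite invr_gt0.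
have qa : q * a ^+ 3 = 1 by rewrite mulVf// gt_eqF.
have dlq : dl = d * q by rewrite -dld mulrAC -mulrA qa mulr1.
pose X := 1 + x ^+ 3.
have X1 : 1 <= X by rewrite lerDl exprn_ge0.
(* the total weight of the far sites *)
have far' : dl * phi (2 * a) * (2 * a ^+ 6) <= 512 * (d * q * (X * G x)).
  have a6 : 1 <= a ^+ 6 by rewrite exprn_ege1.
  have -> : dl * phi (2 * a) * (2 * a ^+ 6) = 2 * (d * q) * (a ^+ 6 * phi (2 * a)).
    by rewrite dlq; ring.
  have : a ^+ 6 * phi (2 * a) <= a ^+ 9 * phi (2 * a).
    by rewrite ler_wpM2r// ler_weXn2l.
  have : G x <= X * G x by rewrite ler_peMl.
  have : 0 <= d * q by rewrite mulr_ge0// ltW.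
  nra.
have farA : 0 <= A * (dl * phi (2 * a)).
  by rewrite !mulr_ge0// ltW.
have E0 : 0 <= E by exact: le_trans E1.
have X0 : 0 <= X by exact: le_trans X1.
have Y0 : 0 <= q * (X * G x) * A.
  exact: mulr_ge0 (mulr_ge0 (ltW q0) (mulr_ge0 X0 G0)) (ltW A0).
rewrite ler_norml; apply/andP; split.
- have := lower_sum M (leqnn _).
  have : corrected_tail sm (u M) <= 256 * (q * (X * G x)).
    have uM0 := u_ge0 M.
    apply: (@le_trans _ _ (G (u M))).
      rewrite /corrected_tail gerDl /sm mulNr oppr_le0 mulr_ge0//.
        by rewrite divr_ge0 ?(ltW a3_gt0).
      rewrite addr_ge0 ?gauss_tail_ge0// mulr_ge0//.
      by rewrite addr_ge0 ?sqr_ge0.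
    have : G (u M) <= phi (u M) by apply: mills_upper; lra.
    have : phi (u M) <= phi (2 * a) by rewrite std_normal_pdf_le//; lra.
    have : q * (a ^+ 9 * phi (2 * a)) <= q * (256 * G x).
      by rewrite ler_wpM2l// ltW.
    have -> : q * (a ^+ 9 * phi (2 * a)) = (q * a ^+ 3) * a ^+ 6 * phi (2 * a).
      by ring.
    rewrite qa mul1r.
    have : phi (2 * a) <= a ^+ 6 * phi (2 * a).
      by rewrite ler_peMl// exprn_ege1.
    have : q * G x <= q * (X * G x) by rewrite ler_wpM2l ?ler_peMl// ltW.
    lra.
  have : G x - 49 * (C * q * (X * G x)) - 16 * (d * q * (X * G x)) <=
         corrected_tail sm (u 0).
    have [c /andP[xc cu] e] := corrected_tailB sm _ _ xu0.
    have h1 : corrected_tail sm x - corrected_tail sm (u 0) <= d * q * phi x.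
      have c0 : 0 <= c by exact: le_trans xc.
      have pc : phi c * (1 + sm * (1 + c ^+ 3)) <= phi x.
        apply: (@le_trans _ _ (phi c)); last exact: std_normal_pdf_le.
        rewrite ler_piMr// gerDl /sm mulNr oppr_le0 mulr_ge0//.
          by rewrite divr_ge0 ?(ltW a3_gt0).
        by rewrite addr_ge0 ?exprn_ge0.
      rewrite e -dlq; apply: (@le_trans _ _ ((u 0 - x) * phi x)).
        by rewrite ler_wpM2l ?subr_ge0.
      by rewrite ler_wpM2r// lerBlDl.
    have h2 : G x - 49 * (C * q * (X * G x)) <= corrected_tail sm x.
      rewrite /corrected_tail lerD2l /sm mulNr lerN2.
      have -> : 49 * (C * q * (X * G x)) = C / a ^+ 3 * (49 * X * G x).
        by rewrite /q; ring.
      by rewrite ler_wpM2l// divr_ge0 ?(ltW a3_gt0).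
    have h3 : d * q * phi x <= d * q * (16 * X * G x).
      by rewrite ler_wpM2l// mulr_ge0// ltW.
    lra.
  move=> h1 h2 h3.
  have : A * (G x - 49 * (C * q * (X * G x)) - 16 * (d * q * (X * G x))
              - 256 * (q * (X * G x))) <=
         A * (corrected_tail sm (u 0) - corrected_tail sm (u M)).
    by rewrite ler_pM2l//; lra.
  have : M%:R * (A * (dl * phi (2 * a))) <= A * (512 * (d * q * (X * G x))).
    have -> : M%:R * (A * (dl * phi (2 * a))) = A * (dl * phi (2 * a) * M%:R).
      by ring.
    have h4 : dl * phi (2 * a) * M%:R <= dl * phi (2 * a) * (2 * a ^+ 6).
      by apply: ler_wpM2l M_le; apply: mulr_ge0 (ltW dl0) (phi0 _).
    by rewrite (ler_pM2l A0); apply: le_trans h4 far'.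
  have : 0 <= (245 * (E * C) + 528 * (d * E)) * (q * (X * G x) * A).
    apply: mulr_ge0 Y0; apply: addr_ge0.
      exact: mulr_ge0 (ler0n _ _) (mulr_ge0 E0 C0).
    exact: mulr_ge0 (ler0n _ _) (mulr_ge0 (ltW d0) E0).
  rewrite /riemann_constant -/E -/X -/q.
  lra.
- have M0 : (0 < M)%N.
    rewrite lt0n; apply/eqP => M0; move: uM; rewrite M0; lra.
  have M1 : (M.-1 < M)%N by rewrite prednK.
  have := upper_sum M.-1 M1.
  rewrite prednK// => h.
  have s0 : 0 <= s by rewrite divr_ge0 ?(ltW a3_gt0)// mulr_ge0// mulr_ge0//; lra.
  have h1 : 0 <= corrected_tail s (u M.-1).
    rewrite addr_ge0 ?gauss_tail_ge0// mulr_ge0// addr_ge0 ?gauss_tail_ge0//.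
    by rewrite mulr_ge0// addr_ge0 ?sqr_ge0.
  have h2 : corrected_tail s (u 0) <= corrected_tail s x.
    have [c /andP[xc cu] e] := corrected_tailB s _ _ xu0.
    rewrite -subr_ge0 e mulr_ge0 ?subr_ge0// mulr_ge0// addr_ge0// mulr_ge0//.
    by rewrite addr_ge0// exprn_ge0// (le_trans x0).
  have h3 : corrected_tail s x <= G x + 245 * (E * C) * (q * (X * G x)).
    rewrite /corrected_tail lerD2l.
    have -> : 245 * (E * C) * (q * (X * G x)) = s * (49 * X * G x).
      by rewrite /s /q; ring.
    by rewrite ler_wpM2l.
  have h4 : dl * (phi x * E) <= 16 * (d * E) * (q * (X * G x)).
    have -> : 16 * (d * E) * (q * (X * G x)) = d * q * (16 * X * G x * E) by ring.
    by rewrite dlq ler_wpM2l ?ler_wpM2r// mulr_ge0// ltW.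
  have h5 : M.-1%:R * (dl * (phi (2 * a) * E)) <= 512 * (d * E) * (q * (X * G x)).
    apply: (@le_trans _ _ (dl * phi (2 * a) * (2 * a ^+ 6) * E)); last first.
      have -> : 512 * (d * E) * (q * (X * G x)) = 512 * (d * q * (X * G x)) * E.
        by ring.
      by rewrite ler_wpM2r.
    have -> : M.-1%:R * (dl * (phi (2 * a) * E)) = dl * phi (2 * a) * M.-1%:R * E.
      by ring.
    rewrite ler_wpM2r// ler_wpM2l//; first by rewrite mulr_ge0// ltW.
    by rewrite (le_trans _ M_le)// ler_nat ltnW.
  have : A * (dl * (phi x * E) + corrected_tail s (u 0) - corrected_tail s (u M.-1)
              + M.-1%:R * (dl * (phi (2 * a) * E))) <=
    A * (G x + (245 * (E * C) + 528 * (d * E)) * (q * (X * G x))).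
    by rewrite ler_pM2l//; lra.
  have : 0 <= (49 * C + 528 * d + 256) * (q * (X * G x) * A).
    by apply: mulr_ge0 Y0; have := C0 => ?; have := d0 => ?; lra.
  rewrite /riemann_constant -/E -/X -/q.
  lra.
Qed.

End Lattice.
End RiemannTail.

(** * The mean-field equation *)

Section MeanField.
Context {R : realType}.
Implicit Types (b m t y z e : R).

Lemma expRD_expRN_gt0 t : 0 < expR t + expR (- t).
Proof. by rewrite addr_gt0 ?expR_gt0. Qed.

(** The left side is the comparison of two consecutive weights. Without
    logarithms, it also makes sense where [1 - y + e] is not positive. *)
Lemma tanh_weightE b y e :
  ((1 - y + e) * expR (b * y) <= (1 + y + e) * expR (- (b * y))) =
  ((1 + e) * tanh (b * y) <= y).
Proof.
rewrite /tanh mulrA ler_pdivrMr ?expRD_expRN_gt0//.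
by apply/idP/idP; lra.
Qed.

Lemma sinh_gt t : 0 < t -> 2 * t < expR t - expR (- t).
Proof.
move=> t0; pose F (s : R) : R := expR s - expR (- s) - 2 * s.
have dF (s : R) : is_derive s 1 F (expR s + expR (- s) - 2).
  rewrite /F; apply: is_derive_eq; rewrite /GRing.scale/=; ring.
have [|c] := @MVT R F (fun s => expR s + expR (- s) - 2) 0 t t0.
  by apply: derivable_within_continuous => s _; have := dF s => -[].
rewrite in_itv/= => /andP[c0 ct].
have E1 : 1 < expR c by rewrite expR_gt1.
have := expRxMexpNx_1 c.
rewrite /F oppr0 expR0; set p := expR c; set q := expR (- c) => pq.
have q0 : 0 < q by rewrite expR_gt0.
have -> : p + q - 2 = q * (p - 1) ^+ 2.
  have -> : q * (p - 1) ^+ 2 = (p * q) * p - 2 * (p * q) + q by ring.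
  by rewrite pq; ring.
have : 0 < q * (p - 1) ^+ 2 * (t - 0).
  by rewrite !mulr_gt0 ?exprn_gt0 ?subr_gt0.
lra.
Qed.

Lemma is_derive_tanh t : is_derive t 1 (@tanh R) (1 - tanh t ^+ 2).
Proof.
have h := expRD_expRN_gt0 t.
have nz : expR t + expR (- t) != 0 by rewrite gt_eqF.
have dV : is_derive t 1 (fun s : R => (expR s + expR (- s))^-1)
   (- ((expR t + expR (- t)) ^- 2) * (expR t - expR (- t))).
  apply: is_derive_eq.
  rewrite /GRing.scale/=; ring.
rewrite /tanh; apply: is_derive_eq.
rewrite /GRing.scale/=; field.
exact: nz.
Qed.

(** The slope of [tanh] through the origin decreases, because
    [t < sinh t * cosh t]. *)
Lemma tanh_ratio_nincr y z : 0 < y -> y <= z -> y * tanh z <= z * tanh y.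
Proof.
move=> y0 yz; pose F (s : R) : R := tanh s / s.
have dF (s : R) : s != 0 ->
    is_derive s 1 F ((s * (1 - tanh s ^+ 2) - tanh s) / s ^+ 2).
  move=> s0; have := is_derive_tanh s => ?.
  have dV : is_derive s 1 (fun s : R => s^-1) (- s ^- 2 *: 1).
    exact: (@is_deriveV R id).
  rewrite /F; apply: is_derive_eq.
  rewrite /GRing.scale/=; field; exact: s0.
have pos s : s \in `[y, z] -> 0 < s.
  by rewrite in_itv/= => /andP[ys _]; exact: lt_le_trans ys.
have [||c cyz e] := @MVT_segment R F
  (fun s => (s * (1 - tanh s ^+ 2) - tanh s) / s ^+ 2) y z yz.
- move=> s; rewrite in_itv/= => /andP[ys _]; apply: dF.
  by rewrite gt_eqF// (lt_trans y0).
- apply: derivable_within_continuous => s /pos s0.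
  by have [] := dF s (negbT (gt_eqF s0)).
have c0 := pos _ cyz.
have slope : c * (1 - tanh c ^+ 2) - tanh c <= 0.
  have := sinh_gt (2 * c) ltac:(lra).
  have -> : 2 * c = c * 2%:R by ring.
  rewrite -mulNr !expRM_natr.
  have := expRxMexpNx_1 c; have := expRD_expRN_gt0 c.
  rewrite /tanh; set p := expR c; set q := expR (- c) => s0 pq h.
  have -> : c * (1 - ((p - q) / (p + q)) ^+ 2) - (p - q) / (p + q) =
    (4 * c * (p * q) - (p ^+ 2 - q ^+ 2)) / (p + q) ^+ 2.
    by field; rewrite gt_eqF.
  rewrite pmulr_lle0 ?invr_gt0 ?exprn_gt0// pq; lra.
have : F z <= F y.
  rewrite -subr_le0 e mulr_le0_ge0 ?subr_ge0//.
  by rewrite pmulr_lle0 ?invr_gt0 ?exprn_gt0.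
rewrite /F ler_pdivrMr ?(lt_le_trans y0)// mulrAC ler_pdivlMr//.
by rewrite mulrC [leRHS]mulrC.
Qed.

Section Root.
Variables (b m : R).
Hypotheses (b0 : 0 < b) (m0 : 0 < m) (mE : m = tanh (b * m)).

Lemma root_expR : (1 - m) * expR (b * m) = (1 + m) * expR (- (b * m)).
Proof.
have := mE; rewrite /tanh.
move=> /(congr1 (fun r => r * (expR (b * m) + expR (- (b * m))))).
rewrite divfK ?gt_eqF ?expRD_expRN_gt0//.
lra.
Qed.

Lemma root_lt1 : m < 1.
Proof.
have := root_expR; have := expR_gt0 (b * m); have := expR_gt0 (- (b * m)).
have := m0; nra.
Qed.

(** The second derivative at [m] of the free energy, entropy minus energy per
    spin; the variance of the magnetization is [n] divided by it. *)
Definition curvature : R := (1 - m ^+ 2)^-1 - b.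

(** With [t = b * m] this is [2 * t < sinh (2 * t)]. *)
Lemma curvature_gt0 : 0 < curvature.
Proof.
have m1 := root_lt1; have h0 := m0.
have m2 : 0 < 1 - m ^+ 2 by nra.
have /sinh_gt : 0 < 2 * (b * m) by rewrite !mulr_gt0.
have -> : 2 * (b * m) = (b * m) * 2%:R by ring.
rewrite -mulNr !expRM_natr.
have := root_expR; have := expRxMexpNx_1 (b * m).
have := expR_gt0 (b * m); have := expR_gt0 (- (b * m)).
set p := expR (b * m); set q := expR (- (b * m)) => q0 p0 pq r h.
suff : b * (1 - m ^+ 2) < 1.
  by rewrite subr_gt0 => ?; rewrite -(ltr_pM2r m2) mulVf ?gt_eqF.
have p2 : p ^+ 2 * (1 - m) = 1 + m.
  have -> : p ^+ 2 * (1 - m) = p * ((1 - m) * p) by ring.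
  rewrite r (_ : p * _ = (p * q) * (1 + m)); last by ring.
  by rewrite pq mul1r.
have q2 : q ^+ 2 * (1 + m) = 1 - m.
  have -> : q ^+ 2 * (1 + m) = q * ((1 + m) * q) by ring.
  rewrite -r (_ : q * _ = (p * q) * (1 - m)); last by ring.
  by rewrite pq mul1r.
have : b * m * 2 * 2 * (1 - m ^+ 2) < (p ^+ 2 - q ^+ 2) * (1 - m ^+ 2).
  by rewrite ltr_pM2r//; lra.
have -> : (p ^+ 2 - q ^+ 2) * (1 - m ^+ 2) =
   p ^+ 2 * (1 - m) * (1 + m) - q ^+ 2 * (1 + m) * (1 - m) by ring.
rewrite p2 q2 => h4.
have : m * (b * (1 - m ^+ 2)) < m * 1 by lra.
by rewrite ltr_pM2l.
Qed.

(** [tanh] lies above the diagonal between its fixed points [0] and [m]. *)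
Lemma tanh_ge_id y : 0 < y -> y <= m -> y <= tanh (b * y).
Proof.
move=> y0 ym.
have := tanh_ratio_nincr (b * y) (b * m); rewrite mulr_gt0// ler_pM2l// -mE.
move=> /(_ isT ym).
by rewrite -!mulrA ler_pM2l// mulrC ler_pM2l.
Qed.

(** Once the line of slope [(1 + e)^-1] is above [tanh (b * _)], it stays above. *)
Lemma tanh_le_id_stable e y z : 0 <= e -> 0 < y -> y <= z ->
  (1 + e) * tanh (b * y) <= y -> (1 + e) * tanh (b * z) <= z.
Proof.
move=> e0 y0 yz h.
have := tanh_ratio_nincr (b * y) (b * z); rewrite mulr_gt0// ler_pM2l//.
move=> /(_ isT yz).
rewrite -!mulrA ler_pM2l// => h1.
rewrite -(ler_pM2l y0).
have := ler_wpM2l e0 h1; have : 0 <= z by lra.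
nra.
Qed.

End Root.

Lemma ln_expansion t : `|t| <= 2^-1 -> `|ln (1 + t) - t| <= 2 * t ^+ 2.
Proof.
rewrite ler_norml => /andP[tl tr].
have t1 : 0 < 1 + t by lra.
have up : ln (1 + t) <= t by apply: le_ln1Dx; lra.
have := @le_ln1Dx R (- (t / (1 + t))).
have -> : 1 + - (t / (1 + t)) = (1 + t)^-1 by field; rewrite gt_eqF.
rewrite lnV ?posrE// ltrN2 lerN2 => lo.
have lo1 : t / (1 + t) <= ln (1 + t).
  by apply: lo; rewrite ltr_pdivrMr//; lra.
have -> : `|ln (1 + t) - t| = t - ln (1 + t) by rewrite ler0_norm; lra.
have : t - t / (1 + t) <= 2 * t ^+ 2.
  have -> : t - t / (1 + t) = t ^+ 2 / (1 + t) by field; rewrite gt_eqF.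
  rewrite ler_pdivrMr//; have := sqr_ge0 t; nra.
lra.
Qed.

Definition log_ratio b y e : R := ln (1 - y + e) - ln (1 + y + e) + 2 * b * y.

(** The choice [m = tanh (b * m)] cancels the constant term. *)
Lemma log_ratio_expansion b m y e : 0 < b -> 0 < m -> m = tanh (b * m) ->
  `|y - m| <= (1 - m) / 4 -> 0 <= e <= (1 - m) / 4 ->
  `|log_ratio b y e + 2 * curvature b m * (y - m)| <=
  10 * (1 - m) ^- 2 * ((y - m) ^+ 2 + e).
Proof.
move=> b0 m0 mE; rewrite ler_norml => /andP[yl yr] /andP[e0 e1].
have m1 := root_lt1 b m m0 mE.
have m10 : 0 < 1 - m by lra.
have m20 : 0 < 1 + m by lra.
pose t1 := (m - y + e) / (1 - m); pose t2 := (y - m + e) / (1 + m).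
have ht1 : `|t1| <= 2^-1.
  by rewrite ler_norml ler_pdivrMr// ler_pdivlMr//; apply/andP; split; lra.
have ht2 : `|t2| <= 2^-1.
  by rewrite ler_norml ler_pdivrMr// ler_pdivlMr//; apply/andP; split; lra.
have p1 : 0 < 1 + t1 by move: ht1; rewrite ler_norml => /andP[]; lra.
have p2 : 0 < 1 + t2 by move: ht2; rewrite ler_norml => /andP[]; lra.
have e_1 : 1 - y + e = (1 - m) * (1 + t1) by rewrite /t1; field; rewrite gt_eqF.
have e_2 : 1 + y + e = (1 + m) * (1 + t2) by rewrite /t2; field; rewrite gt_eqF.
have zero : ln (1 - m) - ln (1 + m) + 2 * b * m = 0.
  have := root_expR b m mE => /(congr1 (@ln R)).
  rewrite !lnM ?posrE ?expR_gt0// !expRK; lra.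
rewrite /log_ratio e_1 e_2 !lnM ?posrE//.
have := ln_expansion t1 ht1; have := ln_expansion t2 ht2.
pose k := (1 - m)^-1.
have k1 : 1 <= k by rewrite -invr1 lef_pV2 ?posrE//; lra.
have kk : (1 - m) ^- 2 = k ^+ 2 by rewrite exprVn.
have k2 : 0 <= (1 + m)^-1 <= k.
  by rewrite invr_ge0 ltW//= lef_pV2 ?posrE//; lra.
have lin : t1 - t2 + 2 * b * (y - m) + 2 * curvature b m * (y - m) =
           e * (k - (1 + m)^-1).
  rewrite /t1 /t2 /k /curvature; field.
  by rewrite !gt_eqF//; nra.
pose D := (y - m) ^+ 2.
have D0 : 0 <= D by exact: sqr_ge0.
have sq1 : t1 ^+ 2 <= k ^+ 2 * (2 * (D + e)).
  rewrite /t1 exprMn mulrC ler_wpM2l ?sqr_ge0//.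
  rewrite /D; have := sqr_ge0 (y - m + e); nra.
have sq2 : t2 ^+ 2 <= k ^+ 2 * (2 * (D + e)).
  rewrite /t2 exprMn mulrC ler_pM ?sqr_ge0//.
    by rewrite lerXn2r ?nnegrE//; case/andP: k2 => //; lra.
  rewrite /D; have := sqr_ge0 (m - y + e); nra.
have k3 : k <= k ^+ 2 by nra.
have : 0 <= e * (k - (1 + m)^-1) <= k ^+ 2 * (D + e).
  case/andP: k2 => k20 k21; rewrite mulr_ge0 ?subr_ge0//=.
  have : e * (k - (1 + m)^-1) <= e * k ^+ 2 by rewrite ler_wpM2l//; lra.
  have : 0 <= k ^+ 2 * D by rewrite mulr_ge0// sqr_ge0.
  lra.
rewrite kk -/D -lin !ler_norml => /andP[? ?] /andP[? ?] /andP[? ?].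
apply/andP; split; lra.
Qed.

End MeanField.

(** * Weights of the magnetization *)

Section Atoms.
Context {R : realType}.
Variables (b : R) (n : nat).
Hypothesis n0 : (0 < n)%N.
Local Notation N := (n%:R : R).

(** Up to the factor [exp (- b / 2)], the total Boltzmann weight of the
    configurations with [k] spins up. *)
Definition cw_atom (b : R) (n k : nat) : R :=
  'C(n, k)%:R * expR (b / (2 * n%:R) * (2 * k%:R - n%:R) ^+ 2).

(** Magnetization halfway between the lattice sites [k] and [k.+1]. *)
Definition mid_mag (n k : nat) : R := (2 * k%:R + 1 - n%:R) / n%:R.

Local Notation a_ := (cw_atom b n).
Local Notation y_ := (mid_mag n).
Local Notation e := (N^-1).

Let N0 : 0 < N. Proof. by rewrite ltr0n. Qed.

Lemma cw_atom_ge0 k : 0 <= a_ k.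
Proof. by rewrite mulr_ge0// expR_ge0. Qed.

Lemma cw_atom_gt0 k : (k <= n)%N -> 0 < a_ k.
Proof. by move=> kn; rewrite mulr_gt0 ?expR_gt0// ltr0n bin_gt0. Qed.

Lemma mid_mag_up k : 1 + y_ k + e = 2 * k.+1%:R / N.
Proof. by rewrite /mid_mag -natr1; field; rewrite gt_eqF. Qed.

Lemma mid_mag_down k : (k <= n)%N -> 1 - y_ k + e = 2 * (n - k)%:R / N.
Proof. by move=> kn; rewrite /mid_mag natrB//; field; rewrite gt_eqF. Qed.

Lemma cw_atomS k : (k <= n)%N ->
  a_ k.+1 * (1 + y_ k + e) = a_ k * ((1 - y_ k + e) * expR (2 * (b * y_ k))).
Proof.
move=> kn; rewrite mid_mag_up mid_mag_down// /cw_atom.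
have -> : b / (2 * N) * (2 * k.+1%:R - N) ^+ 2 =
    b / (2 * N) * (2 * k%:R - N) ^+ 2 + 2 * (b * y_ k).
  by rewrite /mid_mag -natr1; field; rewrite gt_eqF.
rewrite expRD.
have bin : k.+1%:R * 'C(n, k.+1)%:R = (n - k)%:R * 'C(n, k)%:R :> R.
  by rewrite -!natrM mul_bin_left.
transitivity (k.+1%:R * 'C(n, k.+1)%:R * (2 / N) *
   (expR (b / (2 * N) * (2 * k%:R - N) ^+ 2) * expR (2 * (b * y_ k)))).
  by ring.
by rewrite bin; ring.
Qed.

Let up0 k : 0 < 1 + y_ k + e.
Proof. by rewrite mid_mag_up divr_gt0// mulr_gt0. Qed.

Let weight_le (y f : R) :
  ((1 - y + f) * expR (2 * (b * y)) <= 1 + y + f) = ((1 + f) * tanh (b * y) <= y).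
Proof.
rewrite -tanh_weightE -(ler_pM2r (expR_gt0 (- (b * y)))) -!mulrA -expRD.
by congr (_ * expR _ <= _); ring.
Qed.

Lemma cw_atom_decr k : (k <= n)%N ->
  (1 + e) * tanh (b * y_ k) <= y_ k -> a_ k.+1 <= a_ k.
Proof.
move=> kn; rewrite -weight_le => h.
by rewrite -(ler_pM2r (up0 k)) cw_atomS// ler_wpM2l// cw_atom_ge0.
Qed.

Lemma cw_atom_incr k : (k <= n)%N -> 0 < y_ k ->
  y_ k <= tanh (b * y_ k) -> a_ k <= a_ k.+1.
Proof.
move=> kn y0 h.
rewrite -(ler_pM2r (up0 k)) cw_atomS// ler_wpM2l ?cw_atom_ge0//.
have e0 : 0 < e by rewrite invr_gt0.
have lt : y_ k < (1 + e) * tanh (b * y_ k) by nra.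
by apply/ltW; rewrite ltNge weight_le -ltNge.
Qed.

Lemma log_atomS k : (k < n)%N -> ln (a_ k.+1) - ln (a_ k) = log_ratio b (y_ k) e.
Proof.
move=> kn; have kn' := ltnW kn.
have dn0 : 0 < 1 - y_ k + e.
  by rewrite mid_mag_down// divr_gt0// mulr_gt0// ltr0n subn_gt0.
have := cw_atomS k kn'; have := cw_atom_gt0 k kn'; have := cw_atom_gt0 k.+1 kn.
move: (a_ k.+1) (a_ k) => p q p0 q0 /(congr1 (@ln R)).
rewrite [in LHS]lnM ?posrE// [in RHS]lnM ?posrE ?mulr_gt0 ?expR_gt0//.
rewrite [in RHS]lnM ?posrE ?expR_gt0// expRK /log_ratio; lra.
Qed.

End Atoms.

Section Curie.
Context {R : realType}.
Variables (b m : R).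
Hypotheses (b0 : 0 < b) (m0 : 0 < m) (mE : m = tanh (b * m)).

Definition site (b m : R) (n k : nat) : R :=
  (2 * k%:R - n%:R - n%:R * m) / cw_sigma b n m.

Local Notation gam := (curvature b m).

Let gam0 : 0 < gam. Proof. exact: curvature_gt0. Qed.
Let m1 : m < 1. Proof. exact: root_lt1 mE. Qed.

Lemma cw_sigma_sqr n : cw_sigma b n m ^+ 2 * gam = n%:R.
Proof.
have m2 : 0 < 1 - m ^+ 2 by have := m0; have := m1; nra.
have e : 1 - (1 - m ^+ 2) * b = (1 - m ^+ 2) * gam.
  by rewrite /curvature; field; rewrite gt_eqF.
rewrite /cw_sigma sqr_sqrtr e; last first.
  by rewrite divr_ge0// ?mulr_ge0// ltW.
by field; rewrite !gt_eqF.
Qed.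

Lemma cw_sigma_gt0 n : (0 < n)%N -> 0 < cw_sigma b n m.
Proof.
move=> n0; rewrite lt_neqAle sqrtr_ge0 andbT eq_sym; apply/eqP => s0.
have := cw_sigma_sqr n; rewrite s0 expr0n mul0r => /eqP.
by rewrite eq_sym pnatr_eq0 eqn0Ngt n0.
Qed.

Section Window.
Variables (n : nat) (a : R).
Local Notation N := (n%:R : R).
Local Notation sg := (cw_sigma b n m).
Local Notation dl := (2 / sg).
Local Notation d := (2 * Num.sqrt gam).
Local Notation u_ := (site b m n).
Local Notation C1 := (10 * (1 - m) ^- 2 : R).

(** Scale [n ^ (1/6)] from which all the approximations are in force. *)
Definition threshold (b m : R) : R :=
  let d := 2 * Num.sqrt (curvature b m) in
  let C := 10 * (1 - m) ^- 2 in
  1 + d + 32 / (d * (1 - m)) + 4 / (1 - m) + 7 / (m * d)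
  + 4 * C / (d * curvature b m) + C * d / (4 * curvature b m).

Hypotheses (aN : a ^+ 6 = N) (a_large : threshold b m <= a).

Let d0 : 0 < d. Proof. by rewrite mulr_gt0// sqrtr_gt0. Qed.
Let m10 : 0 < 1 - m. Proof. by rewrite subr_gt0. Qed.
Let C10 : 0 < C1. Proof. by rewrite mulr_gt0// invr_gt0 exprn_gt0. Qed.

Let large : [/\ 1 <= a, d <= a, 32 <= a * (d * (1 - m)) & 4 <= a * (1 - m)] /\
  [/\ 7 <= a * (m * d), 4 * C1 <= a * (d * gam) & C1 * d <= a * (4 * gam)].
Proof.
have := a_large; rewrite /threshold.
have h1 : 0 <= 32 / (d * (1 - m)) by rewrite ltW// divr_gt0// mulr_gt0.
have h2 : 0 <= 4 / (1 - m) by rewrite ltW// divr_gt0.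
have h3 : 0 <= 7 / (m * d) by rewrite ltW// divr_gt0// mulr_gt0.
have h4 : 0 <= 4 * C1 / (d * gam) by rewrite ltW// divr_gt0// mulr_gt0.
have h5 : 0 <= C1 * d / (4 * gam) by rewrite ltW// divr_gt0// mulr_gt0.
have := d0 => ? h.
split; split; try lra.
- by rewrite -ler_pdivrMr//; [lra | rewrite mulr_gt0].
- by rewrite -ler_pdivrMr//; lra.
- by rewrite -ler_pdivrMr//; [lra | rewrite mulr_gt0].
- by rewrite -ler_pdivrMr//; [lra | rewrite mulr_gt0].
- by rewrite -ler_pdivrMr//; [lra | rewrite mulr_gt0].
Qed.

Lemma threshold_ge1 : 1 <= a. Proof. by case: large => -[]. Qed.
Let a1 : 1 <= a. Proof. exact: threshold_ge1. Qed.
Let a3_gt0 : 0 < a ^+ 3.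
Proof. by have := a1 => ?; rewrite exprn_gt0//; lra. Qed.

Let n0 : (0 < n)%N.
Proof. by rewrite -(ltr0n R) -aN; have := a1 => ?; rewrite exprn_gt0//; lra. Qed.

Let sg0 : 0 < sg. Proof. exact: cw_sigma_gt0. Qed.

Let sgE : sg * d = 2 * a ^+ 3.
Proof.
suff : sg * Num.sqrt gam = a ^+ 3 by move=> <-; ring.
have h0 : 0 <= sg * Num.sqrt gam.
  exact: mulr_ge0 (ltW sg0) (sqrtr_ge0 _).
apply/eqP; rewrite -(@eqrXn2 _ 2 _ _ isT h0 (ltW a3_gt0)).
by rewrite exprMn (sqr_sqrtr (ltW gam0)) cw_sigma_sqr -aN -exprM.
Qed.

Let dlE : dl * a ^+ 3 = d.
Proof.
have -> : a ^+ 3 = sg * d / 2 by rewrite sgE; field.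
by field; rewrite gt_eqF.
Qed.

Lemma site_step_gt0 : 0 < dl. Proof. by rewrite divr_gt0. Qed.
Let dl0 : 0 < dl. Proof. exact: site_step_gt0. Qed.

Lemma site_step_le1 : dl <= 1.
Proof.
rewrite -(ler_pM2r a3_gt0) dlE mul1r; case: large => -[] _ h _ _ _.
by rewrite (le_trans h)// -[leLHS]expr1 ler_weXn2l.
Qed.

Let dl1 : dl <= 1. Proof. exact: site_step_le1. Qed.

Lemma siteS k : u_ k.+1 = u_ k + dl.
Proof. by rewrite /site -natr1; field; rewrite gt_eqF. Qed.

Let siteD k j : u_ (k + j)%N = u_ k + j%:R * dl.
Proof.
elim: j => [|j IH]; first by rewrite addn0 mul0r addr0.
by rewrite addnS siteS IH -natr1; ring.
Qed.

Lemma site_le k l : (k <= l)%N -> u_ k <= u_ l.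
Proof.
move=> kl; rewrite -(subnKC kl) siteD lerDl mulr_ge0//; exact: ltW.
Qed.

Let tau := sg / N.

Let tauE : tau * (d * a ^+ 3) = 2.
Proof.
rewrite /tau -aN; have -> : a ^+ 6 = a ^+ 3 * a ^+ 3 by ring.
rewrite mulrAC mulrA sgE; field.
have := a1 => ?; rewrite gt_eqF//; lra.
Qed.

Let midE k : mid_mag n k - m = tau * (u_ k + dl / 2).
Proof.
rewrite /mid_mag /tau /site; field.
by rewrite !gt_eqF// ltr0n.
Qed.

Let tau0 : 0 < tau.
Proof. by rewrite divr_gt0// ltr0n. Qed.

Let tau_sqr : tau ^+ 2 = gam^-1 / N.
Proof.
rewrite /tau -(cw_sigma_sqr n); field.
by rewrite !gt_eqF// ltr0n.
Qed.

Let eN : 0 <= N^-1 <= (1 - m) / 4.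
Proof.
have := a1 => ?; case: large => -[] _ _ _ h _.
rewrite invr_ge0 ler0n/= -aN.
have a6 : a <= a ^+ 6 by rewrite -[leLHS]expr1 ler_weXn2l.
have a0 : 0 < a by lra.
apply: (@le_trans _ _ a^-1); first by rewrite lef_pV2 ?posrE// exprn_gt0.
by rewrite -[leLHS]mul1r ler_pdivrMr//; lra.
Qed.

(* The linear term of [log_ratio_expansion] is exactly the increment of
   [- u ^+ 2 / 2], so [level] moves only by the remainder. *)
Let level k := ln (cw_atom b n k) + u_ k ^+ 2 / 2.

Let level_step k : (k < n)%N -> `|mid_mag n k - m| <= (1 - m) / 4 ->
  `|level k.+1 - level k| <= C1 * ((mid_mag n k - m) ^+ 2 + N^-1).
Proof.
move=> kn close.
have -> : level k.+1 - level k =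
    (ln (cw_atom b n k.+1) - ln (cw_atom b n k)) + dl * (u_ k + dl / 2).
  by rewrite /level siteS; field; rewrite gt_eqF.
have -> : dl * (u_ k + dl / 2) = 2 * gam * (mid_mag n k - m).
  rewrite midE mulrA; congr (_ * _).
  by rewrite /tau -[N](cw_sigma_sqr n); field; rewrite !gt_eqF.
rewrite log_atomS//; exact: log_ratio_expansion.
Qed.

Let level_range j k B : (k + j <= n)%N -> - B <= u_ k -> u_ (k + j) <= B ->
  tau * B <= (1 - m) / 4 ->
  `|level (k + j) - level k| <= j%:R * (C1 * (tau ^+ 2 * B ^+ 2 + N^-1)).
Proof.
move=> kjn uk ukj tB.
elim: j kjn ukj => [|j IH] kjn ukj; first by rewrite addn0 subrr normr0 mul0r.
move: kjn ukj; rewrite addnS siteS => kjn ukj.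
have ukj' : u_ (k + j) <= B by have := dl0 => ?; lra.
have := IH (ltnW kjn) ukj' => h.
have : `|level (k + j).+1 - level (k + j)| <= C1 * (tau ^+ 2 * B ^+ 2 + N^-1).
  have ukj2 := site_le _ _ (leq_addr j k).
  have midB : `|u_ (k + j) + dl / 2| <= B.
    by rewrite ler_norml; have := dl0 => ?; apply/andP; split; lra.
  apply: le_trans (level_step _ kjn _) _; last first.
    rewrite ler_pM2l// lerD2r midE exprMn ler_wpM2l ?sqr_ge0//.
    by rewrite -real_normK ?num_real// lerXn2r ?nnegrE// (le_trans _ midB).
  by rewrite midE normrM gtr0_norm// (le_trans _ tB)// ler_pM2l.
have := ler_normD (level (k + j).+1 - level (k + j)) (level (k + j) - level k).
have -> : level (k + j).+1 - level (k + j) + (level (k + j) - level k) =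
  level (k + j).+1 - level k by ring.
rewrite -natr1; lra.
Qed.

Definition weight_constant (b m : R) : R :=
  8 * (10 * (1 - m) ^- 2 * ((curvature b m)^-1 + 1)) /
  (2 * Num.sqrt (curvature b m)).

Local Notation Cw := (weight_constant b m).

Let Cw0 : 0 <= Cw.
Proof.
rewrite /weight_constant divr_ge0 ?(ltW d0)// mulr_ge0// mulr_ge0 ?(ltW C10)//.
by rewrite addr_ge0// invr_ge0 ltW.
Qed.

Let level_error v : 0 <= v ->
  (v + 1) * a ^+ 3 / d * (C1 * (tau ^+ 2 * (v + 1) ^+ 2 + N^-1)) <=
  rel_error Cw a v.
Proof.
move=> v0; pose g := gam^-1.
have g0 : 0 < g by rewrite invr_gt0.
have a3nz : a != 0 by have := a1 => ?; rewrite gt_eqF//; lra.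
have -> : rel_error Cw a v = C1 / d / a ^+ 3 * (8 * (1 + v ^+ 3) * (g + 1)).
  by rewrite /rel_error /weight_constant -/g; ring.
have -> : (v + 1) * a ^+ 3 / d * (C1 * (tau ^+ 2 * (v + 1) ^+ 2 + N^-1)) =
  C1 / d / a ^+ 3 * ((v + 1) * (g * (v + 1) ^+ 2 + 1)).
  have -> : C1 / d / a ^+ 3 = C1 / d * (a ^+ 3 / a ^+ 6).
    have -> : a ^+ 3 / a ^+ 6 = (a ^+ 3)^-1 by field.
    by [].
  by rewrite tau_sqr -aN -/g; ring.
apply: ler_wpM2l.
  exact: divr_ge0 (divr_ge0 (ltW C10) (ltW d0)) (ltW a3_gt0).
have v3 : 0 <= v ^+ 3 by rewrite exprn_ge0.
have h1 : v + 1 <= 8 * (1 + v ^+ 3).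
  have : 0 <= (v - 1) ^+ 2 * (v + 1) by rewrite mulr_ge0 ?sqr_ge0//; lra.
  nra.
have h2 : (v + 1) ^+ 3 <= 8 * (1 + v ^+ 3).
  have : 0 <= (v - 1) ^+ 2 * (v + 1) by rewrite mulr_ge0 ?sqr_ge0//; lra.
  lra.
have : g * (v + 1) ^+ 3 <= g * (8 * (1 + v ^+ 3)) by rewrite ler_pM2l.
lra.
Qed.

Let tau_window v : v <= 3 * a -> tau * (v + 1) <= (1 - m) / 4.
Proof.
move=> va; have := a1 => a1'.
have h : tau * (v + 1) <= tau * (4 * a) by rewrite ler_pM2l//; lra.
apply: (le_trans h).
case: large => -[] _ _ h32 _ _.
have a3d : 0 < d * a ^+ 3 by rewrite mulr_gt0.
rewrite -(ler_pM2r a3d).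
have -> : tau * (4 * a) * (d * a ^+ 3) = 4 * a * (tau * (d * a ^+ 3)) by ring.
rewrite tauE.
have -> : (1 - m) / 4 * (d * a ^+ 3) = a ^+ 2 * (a * (d * (1 - m)) / 4) by field.
have : a <= a ^+ 2 by rewrite -[leLHS]expr1 ler_weXn2l.
nra.
Qed.

(** About [(1 + |u|) * sqrt n] steps from the centre, each with an error of
    order [(1 + u ^+ 2) / n]. *)
Lemma level_close k0 k : (k0 <= n)%N -> `|u_ k0| <= 1 -> (k <= n)%N ->
  `|u_ k| <= 3 * a -> `|level k - level k0| <= rel_error Cw a `|u_ k|.
Proof.
move=> k0n u0 kn uk; set v := `|u_ k|.
have v0 : 0 <= v by exact: normr_ge0.
have := tau_window v uk => tv.
apply: le_trans (level_error v v0).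
have uk' : - v <= u_ k <= v by rewrite -ler_norml.
move: u0; rewrite ler_norml => /andP[u01 u02].
have steps (j : nat) (r : R) : r = j%:R * dl -> r <= v + 1 ->
    j%:R <= (v + 1) * a ^+ 3 / d.
  move=> -> h; rewrite ler_pdivlMr//.
  have -> : j%:R * d = (j%:R * dl) * a ^+ 3 by rewrite -dlE; ring.
  by rewrite ler_pM2r.
have pos : 0 <= C1 * (tau ^+ 2 * (v + 1) ^+ 2 + N^-1).
  by rewrite mulr_ge0 ?(ltW C10)// addr_ge0 ?invr_ge0// mulr_ge0 ?sqr_ge0.
case/andP: uk' => uk1 uk2.
have [kk|kk] := leqP k0 k.
- have := @level_range (k - k0) k0 (v + 1); rewrite subnKC// => h.
  apply: le_trans (h kn _ _ tv) _; [lra|lra|].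
  rewrite ler_wpM2r//; apply: (steps _ (u_ k - u_ k0)); last by lra.
  by rewrite -{1}(subnKC kk) siteD; ring.
- have := @level_range (k0 - k) k (v + 1); rewrite subnKC ?(ltnW kk)// => h.
  rewrite distrC; apply: le_trans (h k0n _ _ tv) _; [lra|lra|].
  rewrite ler_wpM2r//; apply: (steps _ (u_ k0 - u_ k)); last by lra.
  by rewrite -{1}(subnKC (ltnW kk)) siteD; ring.
Qed.

Let far_reach (r : R) : 7 <= a * (r * d) -> 3 * a < r / tau.
Proof.
move=> h; have := a1 => a1'; have a0 : 0 < a by lra.
have a3d : 0 < d * a ^+ 3 by rewrite mulr_gt0.
rewrite ltr_pdivlMr// -(ltr_pM2r a3d).
have -> : 3 * a * tau * (d * a ^+ 3) = 3 * a * (tau * (d * a ^+ 3)) by ring.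
rewrite tauE; have -> : r * (d * a ^+ 3) = a ^+ 2 * (a * (r * d)) by ring.
have : a <= a ^+ 2 by rewrite -[leLHS]expr1 ler_weXn2l.
nra.
Qed.

Lemma site_top : 3 * a < u_ n.+1.
Proof.
case: large => -[] _ _ h32 _ _.
have /lt_trans : 3 * a < (1 - m) / tau by apply: far_reach; lra.
apply; rewrite /site /tau -natr1 invf_div mulrA ltr_pM2r ?invr_gt0//; lra.
Qed.

Lemma site_half : 3 * a < - u_ n./2.
Proof.
have half : 2 * n./2%:R <= N.
  by rewrite -natrM ler_nat mul2n -[leqRHS]odd_double_half leq_addl.
case: large => _ [h7 _ _].
have /lt_le_trans := far_reach _ h7; apply.
rewrite /site /tau invf_div mulrA -mulNr ler_pM2r ?invr_gt0//; lra.
Qed.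

Section Tails.
Variable k0 : nat.
Hypotheses (k0n : (k0 <= n)%N) (uk0 : `|u_ k0| <= 1).

(** Normalized so that the weight of [k0] is [amplitude] times the standard normal
    density at the site of [k0]. *)
Definition amplitude (b m : R) (n k0 : nat) : R :=
  expR (ln (cw_atom b n k0) + site b m n k0 ^+ 2 / 2) / normal_peak 1.

Local Notation A := (amplitude b m n k0).

Lemma amplitude_gt0 : 0 < A.
Proof. by rewrite divr_gt0 ?expR_gt0// normal_peak_gt0// oner_neq0. Qed.

Let atom_bounds k : (k <= n)%N -> `|u_ k| <= 3 * a ->
  A * (normal_pdf 0 1 `|u_ k| * expR (- rel_error Cw a `|u_ k|)) <= cw_atom b n k <=
  A * (normal_pdf 0 1 `|u_ k| * expR (rel_error Cw a `|u_ k|)).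
Proof.
move=> kn uk; have := level_close k0 k k0n uk0 kn uk.
rewrite ler_norml => /andP[lo hi].
have p0 : normal_peak 1 != 0 :> R by rewrite gt_eqF// normal_peak_gt0// oner_neq0.
have AE s : A * (normal_pdf 0 1 `|u_ k| * expR s) =
            expR (level k0 - u_ k ^+ 2 / 2 + s).
  rewrite std_normal_pdfE real_normK ?num_real// 2!expRD /amplitude -/(level k0).
  by field.
have -> : cw_atom b n k = expR (level k - u_ k ^+ 2 / 2).
  by rewrite /level addrK lnK// posrE cw_atom_gt0.
by rewrite !AE !ler_expR; apply/andP; split; lra.
Qed.

Let n_le : n.+1%:R <= 2 * a ^+ 6 :> R.
Proof.
rewrite aN -natr1; have : 1 <= N by rewrite ler1n.
lra.
Qed.

(* Transfer of the decrease from one point, where the expansion of the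
   logarithm decides, to all larger magnetizations. *)
Let atom_decr_right k : (k <= n)%N -> 2 * a <= u_ k ->
  cw_atom b n k.+1 <= cw_atom b n k.
Proof.
move=> kn uk; apply: cw_atom_decr => //.
pose t := tau * (2 * a).
have := a1 => a1'; have a0 : 0 < a by lra.
have t0 : 0 < t by rewrite mulr_gt0// mulr_gt0.
case: large => -[] _ _ h32 _ [_ hg hd].
have ta : t * (d * a ^+ 2) = 4.
  have -> : t * (d * a ^+ 2) = 2 * (tau * (d * a ^+ 3)) by rewrite /t; ring.
  rewrite tauE; ring.
have tm : m + t <= mid_mag n k.
  have : t <= mid_mag n k - m.
    by rewrite midE ler_pM2l//; have := dl0 => ?; lra.
  lra.
have mt0 : 0 < m + t by rewrite addr_gt0.
apply: (tanh_le_id_stable b b0 (N^-1) (m + t)) => //.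
rewrite -tanh_weightE.
have tw : t <= (1 - m) / 4.
  have a23 : 2 * a <= 3 * a by lra.
  have := tau_window (2 * a) a23.
  rewrite mulrDr mulr1 -/t; have := tau0 => ?; lra.
have := log_ratio_expansion b m (m + t) (N^-1) b0 m0 mE.
rewrite (_ : m + t - m = t); last by ring.
rewrite gtr0_norm// => /(_ tw eN).
rewrite ler_norml => /andP[_ up].
have a2 : 0 < d * a ^+ 2 by rewrite mulr_gt0// exprn_gt0.
have a12 : a <= a ^+ 2 by rewrite -[leLHS]expr1 ler_weXn2l.
have q1 : C1 * t <= gam.
  rewrite -(ler_pM2r a2).
  have -> : C1 * t * (d * a ^+ 2) = C1 * (t * (d * a ^+ 2)) by ring.
  rewrite ta; have : a * (d * gam) <= a ^+ 2 * (d * gam).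
    by rewrite ler_pM2r// mulr_gt0.
  lra.
have q2 : C1 * N^-1 <= gam * t.
  rewrite ler_pdivrMr ?ltr0n// -(ler_pM2r a2).
  have -> : gam * t * N * (d * a ^+ 2) = gam * N * (t * (d * a ^+ 2)) by ring.
  rewrite ta -aN.
  have : C1 * d * a ^+ 2 <= a * (4 * gam) * a ^+ 2.
    by rewrite ler_wpM2r// exprn_ge0// ltW.
  have : gam * a ^+ 3 <= gam * a ^+ 6 by rewrite ler_pM2l// ler_weXn2l.
  lra.
have ratio : log_ratio b (m + t) N^-1 <= 0 by nra.
have h1 : 0 < 1 - (m + t) + N^-1.
  have := eN; case/andP; lra.
have h2 : 0 < 1 + (m + t) + N^-1.
  have := eN; case/andP; have := m0; lra.
rewrite -ler_ln ?posrE ?mulr_gt0 ?expR_gt0// !lnM ?posrE ?expR_gt0//.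
rewrite !expRK; move: ratio; rewrite /log_ratio; lra.
Qed.

Lemma right_tail (x : R) k1 : 0 <= x -> x <= a -> x <= u_ k1 -> u_ k1 <= x + dl ->
  `|dl * \sum_(j < n.+1 - k1) cw_atom b n (k1 + j) - A * gauss_tail x| <=
  riemann_constant d Cw * ((1 + x ^+ 3) / a ^+ 3) * (A * gauss_tail x).
Proof.
move=> x0 xa xu ux.
have uk0' j : 0 <= u_ (k1 + j).
  by rewrite (le_trans _ (site_le _ _ (leq_addr j k1)))// (le_trans x0).
have un := site_top.
have k1n : (k1 <= n.+1)%N.
  rewrite leqNgt; apply/negP => /ltnW /site_le.
  have := dl1; have := a1; lra.
apply: (@riemann_tail _ d Cw a x dl A (fun j => u_ (k1 + j))
  (fun j => cw_atom b n (k1 + j))) => //; rewrite ?addn0//.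
- by case: large => -[].
- exact: amplitude_gt0.
- by move=> j; rewrite addnS siteS.
- by move=> j; exact: cw_atom_ge0.
- move=> j jM uj; rewrite -[u_ _]ger0_norm//; apply: atom_bounds.
    by move: jM; rewrite ltn_subRL ltnS.
  by rewrite ger0_norm.
- move=> j jM uj; rewrite addnS; apply: atom_decr_right => //.
  by move: jM; rewrite ltn_subRL addnS ltnS => /ltnW.
- by rewrite subnKC.
- by apply: le_trans n_le; rewrite ler_nat leq_subr.
Qed.

(** Between the middle of the range and [m], [tanh (b * y)] is at least [y], so here
    the decrease away from [m] needs no expansion. *)
Lemma left_tail (x : R) k1 : 0 <= x -> x <= a -> x <= - u_ k1 -> - u_ k1 <= x + dl ->
  `|dl * \sum_(j < k1 - n./2) cw_atom b n (k1 - j) - A * gauss_tail x| <=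
  riemann_constant d Cw * ((1 + x ^+ 3) / a ^+ 3) * (A * gauss_tail x).
Proof.
move=> x0 xa xu ux.
have uh := site_half.
have k1h : (n./2 <= k1)%N.
  rewrite leqNgt; apply/negP => /ltnW /site_le.
  have := dl1; have := a1; lra.
have k1n : (k1 <= n)%N.
  rewrite leqNgt; apply/negP => /ltnW /site_le.
  have : 0 < u_ n.
    rewrite /site divr_gt0//.
    have -> : 2 * N - N - N * m = N * (1 - m) by ring.
    by rewrite mulr_gt0// ltr0n.
  lra.
have uE j : (j <= k1)%N -> - u_ k1 + j%:R * dl = - u_ (k1 - j).
  by move=> jk; rewrite -{1}(subnK jk) siteD; ring.
have jle j : (j < k1 - n./2)%N -> (j <= k1)%N.
  by move=> jM; exact: leq_trans (ltnW jM) (leq_subr _ _).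
have pos j : (j <= k1)%N -> 0 <= - u_ (k1 - j).
  move=> jk; rewrite -uE// addr_ge0//; first by lra.
  by rewrite mulr_ge0// ltW.
apply: (@riemann_tail _ d Cw a x dl A (fun j => - u_ k1 + j%:R * dl)
  (fun j => cw_atom b n (k1 - j))) => //; rewrite ?mul0r ?addr0//.
- by case: large => -[].
- exact: amplitude_gt0.
- by move=> j; rewrite -natr1; ring.
- by move=> j; exact: cw_atom_ge0.
- move=> j jM; rewrite uE ?jle// => uj.
  have := pos j (jle j jM) => p0.
  rewrite -[- u_ _]ger0_norm// normrN; apply: atom_bounds.
    by rewrite (leq_trans (leq_subr _ _)).
  by rewrite -normrN ger0_norm.
- move=> j jM _.
  have kE : (k1 - j = (k1 - j.+1).+1)%N.
    by rewrite subnSK// (leq_trans (ltnW jM))// leq_subr.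
  rewrite kE; set k := (k1 - j.+1)%N.
  have y0 : 0 < mid_mag n k :> R.
    rewrite /mid_mag divr_gt0 ?ltr0n// subr_gt0 -natrM natr1 ltr_nat.
    rewrite ltnS mul2n ltnW// -ltn_half_double /k ltn_subRL addnC.
    by rewrite -ltn_subRL.
  apply: cw_atom_incr => //; first exact: leq_trans (leq_subr _ _) k1n.
  apply: (tanh_ge_id b m b0 m0 mE) => //.
  rewrite -subr_le0 midE pmulr_rle0//.
  have := pos j (jle j (ltnW jM)); rewrite kE -/k siteS; have := dl0; lra.
- by rewrite uE ?leq_subr// subKn.
- by apply: le_trans n_le; rewrite ler_nat (leq_trans (leq_subr _ _))// leqW.
Qed.

End Tails.

End Window.
End Curie.

(** * Tails of the magnetization weights *)

Lemma monotone_pred_cut (P : pred nat) (h t : nat) :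
  (forall k l, (k <= l)%N -> P k -> P l) -> ~~ P h -> P t ->
  exists k1, [/\ (h < k1)%N, (k1 <= t)%N, forall k, P k = (k1 <= k)%N & ~~ P k1.-1].
Proof.
move=> Pmono Ph Pt; case: (ex_minnP (ex_intro P t Pt)) => k1 Pk1 min.
have cut k : P k = (k1 <= k)%N.
  by apply/idP/idP => [/min//|kk]; exact: Pmono Pk1.
have hk : (h < k1)%N by rewrite ltnNge -cut.
exists k1; split=> //; first exact: min.
by rewrite cut -ltnNge prednK// (leq_ltn_trans _ hk).
Qed.

Section SumShift.
Variables (V : nmodType) (F : nat -> V) (n : nat).

Lemma sum_shift_up k1 :
  \sum_(k < n | (k1 <= k)%N) F k = \sum_(j < n - k1) F (k1 + j)%N.
Proof.
rewrite -(big_geq_mkord k1 n xpredT F) /= -{1}[k1]add0n big_addn big_mkord.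
by apply: eq_bigr => j _; rewrite addnC.
Qed.

Lemma sum_shift_down h k2 : (k2 < n)%N ->
  \sum_(k < n | (h < k)%N && (k < k2.+1)%N) F k =
  \sum_(j < k2 - h) F (k2 - j)%N.
Proof.
move=> k2n.
have -> : \sum_(k < n | (h < k)%N && (k < k2.+1)%N) F k =
          \sum_(h.+1 <= k < k2.+1) F k.
  rewrite (big_nat_widen _ _ n) // big_geq_mkord.
  by apply: eq_bigl => k; rewrite andbC.
rewrite big_nat_rev /= -{1}[h.+1]add0n big_addn subSS big_mkord.
apply: eq_bigr => j _; congr F; lia.
Qed.

End SumShift.

Section Ratios.
Context {R : realType}.
Variables (b m : R).
Hypotheses (b0 : 0 < b) (m0 : 0 < m) (mE : m = tanh (b * m)).

Local Notation a_ := (cw_atom b).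

(** Total weight of the configurations of positive magnetization that
    satisfy [Q]. *)
Definition positive_weight (b : R) (n : nat) (Q : pred nat) : R :=
  \sum_(k < n.+1 | (n < k.*2)%N && Q k) cw_atom b n k.

Section Large.
Variables (n : nat) (a : R).
Hypotheses (aN : a ^+ 6 = n%:R :> R) (a_large : threshold b m <= a).

Local Notation u_ := (site b m n).
Local Notation dl := (2 / cw_sigma b n m).
Local Notation K :=
  (riemann_constant (2 * Num.sqrt (curvature b m)) (weight_constant b m)).

Let mono k l : (k <= l)%N -> u_ k <= u_ l.
Proof. exact: (site_le _ _ b0 m0 mE _ _ aN a_large). Qed.

Let top : 3 * a < u_ n.+1. Proof. exact: (site_top _ _ b0 m0 mE _ _ aN a_large). Qed.
Let bot : 3 * a < - u_ n./2. Proof. exact: (site_half _ _ b0 m0 mE _ _ aN a_large). Qed.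
Let a1 : 1 <= a. Proof. exact: (threshold_ge1 _ _ b0 m0 mE _ a_large). Qed.
Let step k : u_ k.+1 = u_ k + dl. Proof. exact: (siteS _ _ b0 m0 mE _ _ aN a_large). Qed.
Let dl0 : 0 < dl. Proof. exact: (site_step_gt0 _ _ b0 m0 mE _ _ aN a_large). Qed.
Let dl1 : dl <= 1. Proof. exact: (site_step_le1 _ _ b0 m0 mE _ _ aN a_large). Qed.

Let cut_ge x : 0 <= x -> x <= a -> exists k1,
  [/\ (n./2 < k1)%N, (k1 <= n.+1)%N, forall k, (x <= u_ k) = (k1 <= k)%N,
      x <= u_ k1 & u_ k1 <= x + dl].
Proof.
move=> x0 xa; have := top; have := bot; have := a1 => ? ? ?.
have [k l kl xk|||k1 [hk kt cut low]] :=
    @monotone_pred_cut (fun k => x <= u_ k) n./2 n.+1.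
- exact: le_trans (mono _ _ kl).
- by rewrite -ltNge; lra.
- by lra.
exists k1; split=> //; first by rewrite cut.
have k10 : (0 < k1)%N by exact: leq_ltn_trans hk.
by move: low; rewrite -ltNge -{2}(prednK k10) step; lra.
Qed.

Let cut_gt x : 0 <= x -> x <= a -> exists k1,
  [/\ (n./2 <= k1)%N, (k1 <= n)%N, forall k, (- x < u_ k) = (k1 < k)%N,
      x <= - u_ k1 & - u_ k1 <= x + dl].
Proof.
move=> x0 xa; have := top; have := bot; have := a1 => ? ? ?.
have [k l kl xk|||[|k1] [hk kt cut low]] :=
    @monotone_pred_cut (fun k => - x < u_ k) n./2 n.+1.
- exact: lt_le_trans (mono _ _ kl).
- by rewrite -leNgt; lra.
- by lra.
- by [].
exists k1; split=> //.
  by move: low; rewrite -leNgt /=; lra.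
have := cut k1.+1; rewrite leqnn step; lra.
Qed.

Let positive_half k : (n < k.*2)%N = (n./2 < k)%N.
Proof. by rewrite ltn_half_double. Qed.

Let ref : exists k0, [/\ (n./2 < k0)%N, (k0 <= n)%N,
  forall k, (0 <= u_ k) = (k0 <= k)%N, 0 <= u_ k0 & u_ k0 <= dl].
Proof.
have := top; have := a1; have := dl1 => ? ? ?.
have [k0 [h t c l r]] := cut_ge 0 (lexx _) ltac:(lra).
rewrite add0r in r; exists k0; split=> //.
rewrite -ltnS ltn_neqAle t andbT; apply/eqP => e.
by move: r; rewrite e; lra.
Qed.

(** The last bound combines the right tail from [0] with the left tail below [0],
    each of mass [A / 2]. *)
Lemma tail_weights : exists2 A : R, 0 < A &
  [/\ forall x, 0 <= x -> x <= a ->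
        `|dl * positive_weight b n (fun k => x <= u_ k) - A * gauss_tail x| <=
        K * ((1 + x ^+ 3) / a ^+ 3) * (A * gauss_tail x),
      forall x, 0 <= x -> x <= a ->
        `|dl * positive_weight b n (fun k => u_ k <= - x) - A * gauss_tail x| <=
        K * ((1 + x ^+ 3) / a ^+ 3) * (A * gauss_tail x) &
      `|dl * positive_weight b n xpredT - A| <= K * (1 / a ^+ 3) * A].
Proof.
have [k0 [hk0 k0n k0cut k00 k0dl]] := ref.
have uk0 : `|u_ k0| <= 1 by rewrite ger0_norm// (le_trans k0dl).
have rt := right_tail b m b0 m0 mE n a aN a_large k0 k0n uk0.
have lt := left_tail b m b0 m0 mE n a aN a_large k0 k0n uk0.
have right x : 0 <= x -> x <= a ->
    `|dl * positive_weight b n (fun k => x <= u_ k) -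
      amplitude b m n k0 * gauss_tail x| <=
    K * ((1 + x ^+ 3) / a ^+ 3) * (amplitude b m n k0 * gauss_tail x).
  move=> x0 xa; have [k1 [hk kt cut lo hi]] := cut_ge x x0 xa.
  have -> : positive_weight b n (fun k => x <= u_ k) =
            \sum_(j < n.+1 - k1) a_ n (k1 + j).
    rewrite -sum_shift_up; apply: eq_bigl => k; rewrite cut positive_half.
    by rewrite andb_idl// => /(leq_trans hk).
  exact: rt.
have left x (Q : pred nat) k1 : 0 <= x -> x <= a -> (k1 <= n)%N ->
    (forall k, Q k = ~~ (k1 < k)%N) -> x <= - u_ k1 -> - u_ k1 <= x + dl ->
    `|dl * positive_weight b n Q - amplitude b m n k0 * gauss_tail x| <=
    K * ((1 + x ^+ 3) / a ^+ 3) * (amplitude b m n k0 * gauss_tail x).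
  move=> x0 xa k1n cut lo hi.
  have -> : positive_weight b n Q = \sum_(j < k1 - n./2) a_ n (k1 - j).
    rewrite -(@sum_shift_down _ _ n.+1)//.
    by apply: eq_bigl => k; rewrite cut positive_half -leqNgt ltnS.
  exact: lt.
exists (amplitude b m n k0); first exact: amplitude_gt0.
split=> //.
  move=> x x0 xa; have [k1 [hk kt cut lo hi]] := cut_gt x x0 xa.
  by apply: (left x _ k1) => // k; rewrite -cut leNgt.
have k00' : (0 < k0)%N by exact: leq_ltn_trans hk0.
have a0 : 0 <= a by exact: le_trans a1.
have k0pred : k0.-1.+1 = k0 by rewrite prednK.
have below : u_ k0 = u_ k0.-1 + dl by rewrite -step k0pred.
have kp : ~~ (0 <= u_ k0.-1) by rewrite k0cut -ltnNge k0pred.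
have h1 := right 0 (lexx _) a0.
have h2 : `|dl * positive_weight b n (fun k => ~~ (0 <= u_ k)) -
      amplitude b m n k0 * gauss_tail 0| <=
    K * ((1 + 0 ^+ 3) / a ^+ 3) * (amplitude b m n k0 * gauss_tail 0).
  apply: (left 0 _ k0.-1) => //.
  - exact: leq_trans (leq_pred _) k0n.
  - by move=> k; rewrite k0cut k0pred.
  - by move: kp; rewrite -ltNge => kp; lra.
  - lra.
have -> : positive_weight b n xpredT =
    positive_weight b n (fun k => 0 <= u_ k) +
    positive_weight b n (fun k => ~~ (0 <= u_ k)).
  rewrite /positive_weight (bigID (fun k : 'I_n.+1 => 0 <= u_ k)) /=.
  by congr (_ + _); apply: eq_bigl => k; rewrite andbT.
move: h1 h2; rewrite gauss_tail0 expr0n addr0 !ler_norml.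
by move=> /andP[? ?] /andP[? ?]; apply/andP; split; lra.
Qed.

End Large.
Lemma ratio_close (dl A g K r t eta q : R) : 0 < dl -> 0 < A -> 0 < g -> 0 <= K ->
  K * q <= 2^-1 -> q <= eta ->
  `|dl * r - A * g| <= K * eta * (A * g) -> `|dl * t - A| <= K * q * A ->
  `|r / t / g - 1| <= 4 * K * eta.
Proof.
move=> dl0 A0 g0 K0 Kq qeta.
pose r' := dl * r / (A * g); pose t' := dl * t / A.
have Ag0 : 0 < A * g by rewrite mulr_gt0.
have -> : dl * r - A * g = (r' - 1) * (A * g).
  by rewrite /r'; field; rewrite !gt_eqF.
have -> : dl * t - A = (t' - 1) * A by rewrite /t'; field; rewrite gt_eqF.
rewrite (normrM _ (A * g)) (normrM _ A) (gtr0_norm Ag0) (gtr0_norm A0) !ler_pM2r//.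
move=> hr ht.
have t'2 : 2^-1 <= t'.
  by have := le_trans ht Kq; rewrite ler_norml => /andP[]; lra.
have t'0 : 0 < t' by lra.
have t0 : t != 0.
  by apply/eqP => t0; move: t'0; rewrite /t' t0 mulr0 mul0r ltxx.
have -> : r / t / g - 1 = (r' - t') / t'.
  by rewrite /r' /t'; field; rewrite t0 !gt_eqF.
rewrite normrM normfV (gtr0_norm t'0) ler_pdivrMr//.
have : `|r' - t'| <= `|r' - 1| + `|t' - 1|.
  have -> : r' - t' = (r' - 1) - (t' - 1) by ring.
  exact: ler_normB.
have : K * q <= K * eta by rewrite ler_wpM2l.
have Keta : 0 <= K * eta by exact: le_trans hr.
nra.
Qed.

Lemma positive_weight_ge0 n Q : 0 <= positive_weight b n Q.
Proof. by apply: sumr_ge0 => k _; exact: cw_atom_ge0. Qed.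

Lemma positive_weight_le n Q : positive_weight b n Q <= positive_weight b n xpredT.
Proof.
rewrite [leRHS]/positive_weight (bigID (fun k : 'I_n.+1 => Q k)) /=.
rewrite [X in _ <= X + _](_ : _ = positive_weight b n Q); last first.
  by apply: eq_bigl => k; rewrite andbT.
by rewrite lerDl sumr_ge0// => k _; exact: cw_atom_ge0.
Qed.

Lemma positive_weight_gt0 n : (0 < n)%N -> 0 < positive_weight b n xpredT.
Proof.
move=> n0; rewrite /positive_weight (bigD1 ord_max) /=; last first.
  by rewrite andbT -addnn -{1}[n]addn0 ltn_add2l.
rewrite ltr_pwDl ?cw_atom_gt0// sumr_ge0// => k _; exact: cw_atom_ge0.
Qed.

(** For bounded [n] the right-hand side is bounded below, so any constant
    that dominates the trivial estimate works. *)
Lemma root_tails : exists C : R, forall (n : nat) (a x : R), (0 < n)%N ->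
  1 <= a -> a ^+ 6 = n%:R -> 0 <= x -> x <= a ->
  `|positive_weight b n (fun k => x <= site b m n k) /
      positive_weight b n xpredT / gauss_tail x - 1| <= C * ((1 + x ^+ 3) / a ^+ 3)
  /\
  `|positive_weight b n (fun k => site b m n k <= - x) /
      positive_weight b n xpredT / gauss_tail x - 1| <= C * ((1 + x ^+ 3) / a ^+ 3).
Proof.
pose K := riemann_constant (2 * Num.sqrt (curvature b m)) (weight_constant b m).
have K0 : 0 <= K.
  have C1 : 0 <= weight_constant b m.
    rewrite /weight_constant divr_ge0// ?mulr_ge0 ?addr_ge0 ?invr_ge0 ?sqrtr_ge0//.
      by rewrite exprn_ge0// subr_ge0 ltW// (root_lt1 b m m0 mE).
    exact/ltW/curvature_gt0.
  have C2 : 0 <= 2 * Num.sqrt (curvature b m) by rewrite mulr_ge0 ?sqrtr_ge0.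
  rewrite /K /riemann_constant; move: C1 C2.
  move: (weight_constant b m) (2 * Num.sqrt (curvature b m)) => w d w0 d0.
  have E0 := expR_ge0 (28 * w).
  have := mulr_ge0 E0 w0; have := mulr_ge0 d0 E0; lra.
pose astar := Num.max (threshold b m) (2 * K).
pose gs := gauss_tail (Num.max astar 0).
have gs0 : 0 < gs by apply: gauss_tail_gt0; rewrite le_max lexx orbT.
pose C' := (gs^-1 + 1) * (Num.max astar 0) ^+ 3.
have C'0 : 0 <= C'.
  rewrite mulr_ge0// ?addr_ge0 ?invr_ge0 ?(ltW gs0)// exprn_ge0//.
  by rewrite le_max lexx orbT.
exists (4 * K + C') => n a x n0 a1 aN x0 xa.
have a0 : 0 < a by rewrite (lt_le_trans _ a1).
have a3 : 0 < a ^+ 3 by rewrite exprn_gt0.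
have x3 : 0 <= x ^+ 3 by rewrite exprn_ge0.
have eta0 : 0 <= (1 + x ^+ 3) / a ^+ 3 by rewrite divr_ge0 ?addr_ge0// ltW.
have g0 := gauss_tail_gt0 x x0.
have [la|sa] := leP astar a.
  have [th K2] : threshold b m <= a /\ 2 * K <= a.
    by move: la; rewrite ge_max => /andP[].
  have [A A0 [hr hl ht]] := tail_weights n a aN th.
  have dl0 := site_step_gt0 b m b0 m0 mE n a aN th.
  have Kq : K * (1 / a ^+ 3) <= 2^-1.
    rewrite mulrA mulr1 ler_pdivrMr//.
    have : a <= a ^+ 3 by rewrite -[leLHS]expr1 ler_weXn2l.
    lra.
  have qeta : 1 / a ^+ 3 <= (1 + x ^+ 3) / a ^+ 3.
    by rewrite ler_pM2r ?invr_gt0// lerDl.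
  have C'eta : 0 <= C' * ((1 + x ^+ 3) / a ^+ 3) by rewrite mulr_ge0.
  have close r := @ratio_close _ _ _ _ r _ _ _ dl0 A0 g0 K0 Kq qeta.
  split; rewrite mulrDl.
    by apply: le_trans (close _ _ (hr x x0 xa) ht) _; rewrite lerDl.
  by apply: le_trans (close _ _ (hl x x0 xa) ht) _; rewrite lerDl.
suff trivial Q : `|positive_weight b n Q / positive_weight b n xpredT /
    gauss_tail x - 1| <= (4 * K + C') * ((1 + x ^+ 3) / a ^+ 3).
  by split; exact: trivial.
have am : a <= Num.max astar 0 by rewrite le_max ltW.
have m0' : 0 <= Num.max astar 0 by rewrite le_max lexx orbT.
have gg : gs <= gauss_tail x by apply: gauss_tail_nincr => //; exact: le_trans am.
have T0 := positive_weight_gt0 n n0.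
have p01 : 0 <= positive_weight b n Q / positive_weight b n xpredT <= 1.
  rewrite divr_ge0 ?positive_weight_ge0//= ler_pdivrMr// mul1r.
  exact: positive_weight_le.
move: p01; set p := positive_weight b n Q / _ => /andP[p0 p1].
have pg : p / gauss_tail x <= gs^-1.
  rewrite ler_pdivrMr//; apply: (le_trans p1).
  by rewrite -(mulVf (negbT (gt_eqF gs0))) ler_pM2l ?invr_gt0.
have pg0 : 0 <= p / gauss_tail x by rewrite divr_ge0 ?(ltW g0).
have : gs^-1 + 1 <= C' * ((1 + x ^+ 3) / a ^+ 3).
  rewrite /C' mulrA ler_pdivlMr// -mulrA ler_wpM2l//.
    by rewrite addr_ge0// invr_ge0 ltW.
  have : a ^+ 3 <= (Num.max astar 0) ^+ 3 by rewrite lerXn2r ?nnegrE// ltW.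
  have : 0 <= (Num.max astar 0) ^+ 3 * x ^+ 3 by rewrite mulr_ge0// exprn_ge0.
  lra.
have : 0 <= 4 * K * ((1 + x ^+ 3) / a ^+ 3).
  exact: mulr_ge0 (mulr_ge0 (ler0n _ _) K0) eta0.
move=> h1 h2; rewrite mulrDl ler_norml.
have gi : 0 < gs^-1 by rewrite invr_gt0.
by apply/andP; split; lra.
Qed.

End Ratios.

(** * From configurations to magnetizations *)

Section Configurations.
Context {R : realType}.
Variables (b : R) (n : nat).
Local Notation conf := {ffun 'I_n -> bool}.

Definition up_count (s : conf) : nat := #|[set i | s i]%SET|.

Lemma up_count_le s : (up_count s <= n)%N.
Proof. by rewrite (leq_trans (max_card _))// card_ord. Qed.

Lemma sum_spin (s : conf) :
  \sum_(i < n) spin R (s i) = 2 * (up_count s)%:R - n%:R.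
Proof.
have -> : (up_count s)%:R = \sum_(i < n) (s i)%:R :> R.
  rewrite /up_count -sum1_card natr_sum big_mkcond /=.
  by apply: eq_bigr => i _; rewrite inE; case: (s i).
have -> : n%:R = \sum_(i < n) 1 :> R by rewrite sumr_const card_ord.
rewrite mulr_sumr -sumrB; apply: eq_bigr => i _; rewrite /spin.
by case: (s i) => /=; ring.
Qed.

Lemma sum_pairs (f : 'I_n -> R) :
  (\sum_(i < n) f i) ^+ 2 = \sum_(i < n) f i ^+ 2 +
    2 * \sum_(i < n) \sum_(j < n | (i < j)%N) f i * f j.
Proof.
rewrite expr2 mulr_suml.
have -> : \sum_(i < n) f i * (\sum_(j < n) f j) =
  \sum_(i < n) (f i ^+ 2 + (\sum_(j < n | (i < j)%N) f i * f j +
                            \sum_(j < n | (j < i)%N) f i * f j)).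
  apply: eq_bigr => i _; rewrite mulr_sumr (bigD1 i) //=; congr (_ + _).
  rewrite (bigID (fun j : 'I_n => (i < j)%N)) /=; congr (_ + _);
    apply: eq_bigl => j; rewrite -val_eqE /=; lia.
rewrite big_split big_split /=; congr (_ + _).
rewrite [X in _ + X](_ : _ = \sum_(i < n) \sum_(j < n | (i < j)%N) f i * f j).
  ring.
rewrite (exchange_big_dep xpredT)//=.
by apply: eq_bigr => i _; apply: eq_bigr => j _; rewrite mulrC.
Qed.

Lemma curie_weiss_weightE (s : conf) : (0 < n)%N ->
  curie_weiss_weight b 0 s =
  expR (- (b / 2)) * expR (b / (2 * n%:R) * (2 * (up_count s)%:R - n%:R) ^+ 2).
Proof.
move=> n0; rewrite /curie_weiss_weight mulr0 mul0r addr0 -expRD; congr expR.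
have := sum_pairs (fun i => spin R (s i)); rewrite sum_spin => ->.
have -> : \sum_(i < n) spin R (s i) ^+ 2 = n%:R.
  rewrite -[in RHS](card_ord n) -sumr_const; apply: eq_bigr => i _.
  by rewrite /spin; case: (s i) => /=; ring.
by field; rewrite pnatr_eq0 -lt0n.
Qed.

Lemma sum_by_up_count (F : nat -> R) (Q : pred nat) :
  \sum_(s : conf | Q (up_count s)) F (up_count s) =
  \sum_(k < n.+1 | Q k) 'C(n, k)%:R * F k.
Proof.
have upS s : (up_count s < n.+1)%N by rewrite ltnS up_count_le.
rewrite (partition_big (fun s => Ordinal (upS s)) (fun k : 'I_n.+1 => Q k))//=.
apply: eq_bigr => k Qk.
rewrite (eq_bigl (fun s => up_count s == k)); last first.
  move=> s /=; rewrite -val_eqE /=; apply: andb_idl => /eqP ->//.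
rewrite (eq_bigr (fun=> F k)); last by move=> s /eqP ->.
rewrite sumr_const mulr_natl; congr (_ *+ _).
have <- : #|[set A : {set 'I_n} | #|A| == k]%SET| = 'C(n, k).
  by rewrite card_draws card_ord.
pose f (A : {set 'I_n}) : conf := [ffun i => i \in A].
have fI : injective f.
  by move=> A B /ffunP AB; apply/setP => i; have := AB i; rewrite !ffunE.
rewrite -(card_imset _ fI); apply: eq_card => s.
apply/idP/imsetP => [su|[A]].
  exists [set i | s i]%SET; first by rewrite inE.
  by apply/ffunP => i; rewrite ffunE inE.
rewrite inE => /eqP <- ->.
rewrite unfold_in /= /up_count; apply/eqP; apply: eq_card => i.
by rewrite !inE ffunE.
Qed.

End Configurations.

Section Law.
Context {R : realType} {d : measure_display} {T : measurableType d}.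
Variables (P : probability T R) (b : R) (n : nat) (Sigma : 'I_n -> {RV P >-> R}).
Hypotheses (n0 : (0 < n)%N) (law : curie_weiss_distributed b 0 Sigma).
Local Notation conf := {ffun 'I_n -> bool}.

Let spin_inj : injective (spin R).
Proof. by move=> [] [] // /eqP; rewrite /spin -subr_eq0 => /eqP; lra. Qed.

Let E (s : conf) := [set w | forall i, Sigma i w = spin R (s i)].

Let mE s : measurable (E s).
Proof.
rewrite (_ : E s = \bigcap_(i in [set: 'I_n]) (Sigma i @^-1` [set spin R (s i)])).
  exact: fin_bigcap_measurable.
by rewrite eqEsubset; split=> w /= h i => [_|]; exact: h.
Qed.

Let disjE : trivIset setT E.
Proof.
move=> s t _ _ [w [ws wt]]; apply/ffunP => i; apply: spin_inj.
by rewrite -ws -wt.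
Qed.

Let coverE w : exists s, E s w.
Proof.
exists [ffun i => Sigma i w == 1] => i; rewrite ffunE /spin.
case: law => /(_ i w) [] -> _; first by rewrite eqxx.
by case: eqP => // h; lra.
Qed.

Let prob_configurations (Q : R -> bool) :
  P [set w | Q (total_spin Sigma w)] =
  (\sum_(s : conf | Q (\sum_(i < n) spin R (s i))) curie_weiss_pmf b 0 s)%:E.
Proof.
pose D := [set s : conf | Q (\sum_(i < n) spin R (s i))].
have -> : [set w | Q (total_spin Sigma w)] = \bigcup_(s in D) E s.
  rewrite eqEsubset; split=> w /=.
    have [s Es] := coverE w; rewrite /total_spin => Qw; exists s => //.
    by rewrite /D /= -(eq_bigr _ (fun i _ => Es i)).
  by case=> s Ds Es; rewrite /total_spin (eq_bigr _ (fun i _ => Es i)).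
rewrite measure_fin_bigcup//; last 2 first.
- exact: finite_finset.
- by move=> s t _ _; exact: disjE.
rewrite (eq_fsbigr (fun s => (curie_weiss_pmf b 0 s)%:E)); last first.
  by move=> s _; case: law => _ h; exact: h.
have -> : D = [set` [pred s : conf | Q (\sum_(i < n) spin R (s i))]].
  by rewrite eqEsubset; split=> s; rewrite /D /= inE.
rewrite -(@bigfs _ _ _ _ (index_enum conf)) ?index_enum_uniq//; last first.
  by move=> s _; rewrite mem_index_enum.
by rewrite -sumEFin.
Qed.

Lemma prob_total_spin : exists2 c : R, c != 0 & forall Q : R -> bool,
  P [set w | Q (total_spin Sigma w)] =
  (c * \sum_(k < n.+1 | Q (2 * k%:R - n%:R)) cw_atom b n k)%:E.
Proof.
exists ((curie_weiss_Z b 0 n)^-1 * expR (- (b / 2))).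
  rewrite mulf_neq0 ?invr_eq0// ?gt_eqF ?expR_gt0//.
  rewrite /curie_weiss_Z (bigD1 [ffun=> true]) //= ltr_pwDl ?expR_gt0//.
  by apply: sumr_ge0 => s _; exact: expR_ge0.
move=> Q; rewrite prob_configurations; congr EFin.
rewrite /curie_weiss_pmf -mulr_sumr -mulrA; congr (_ * _).
rewrite (eq_bigl (fun s => Q (2 * (up_count n s)%:R - n%:R))); last first.
  by move=> s; rewrite sum_spin.
rewrite (eq_bigr (fun s => expR (- (b / 2)) *
  expR (b / (2 * n%:R) * (2 * (up_count n s)%:R - n%:R) ^+ 2))); last first.
  by move=> s _; rewrite curie_weiss_weightE.
rewrite -mulr_sumr; congr (_ * _).
exact: (sum_by_up_count n (fun k => expR (b / (2 * n%:R) * (2 * k%:R - n%:R) ^+ 2))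
  (fun k => Q (2 * k%:R - n%:R))).
Qed.

(** The normalizing constant cancels in a conditional probability. *)
Lemma cond_prob_total_spin (Q B : R -> bool) :
  cond_prob P [set w | Q (total_spin Sigma w)] [set w | B (total_spin Sigma w)] =
  (\sum_(k < n.+1 | B (2 * k%:R - n%:R) && Q (2 * k%:R - n%:R)) cw_atom b n k) /
  (\sum_(k < n.+1 | B (2 * k%:R - n%:R)) cw_atom b n k).
Proof.
have [c c0 pE] := prob_total_spin.
rewrite /cond_prob.
have -> : [set w | Q (total_spin Sigma w)] `&` [set w | B (total_spin Sigma w)] =
    [set w | (fun r => B r && Q r) (total_spin Sigma w)].
  by rewrite eqEsubset; split=> w /= => [[-> ->]|/andP[]].
rewrite (pE (fun r => B r && Q r)) (pE B) /= invfM mulrACA divff// mul1r.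
by [].
Qed.

End Law.

Section Final.
Context {R : realType}.

Lemma cw_atom_rev (b : R) n k : (k <= n)%N -> cw_atom b n (n - k) = cw_atom b n k.
Proof.
move=> kn; rewrite /cw_atom bin_sub//; congr (_ * expR (_ * _)).
by rewrite natrB//; ring.
Qed.

Lemma positive_weightE (b : R) n (Q : pred nat) :
  \sum_(k < n.+1 | (0 < 2 * k%:R - n%:R :> R) && Q k) cw_atom b n k =
  positive_weight b n Q.
Proof.
by apply: eq_bigl => k; rewrite subr_gt0 -natrM ltr_nat mul2n.
Qed.

(** The symmetry [k |-> n - k] exchanges the two phases. *)
Lemma negative_weightE (b : R) n (Q : pred nat) :
  \sum_(k < n.+1 | (2 * k%:R - n%:R < 0 :> R) && Q k) cw_atom b n k =
  positive_weight b n (fun k => Q (n - k)%N).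
Proof.
rewrite /positive_weight [RHS](reindex_inj rev_ord_inj) /=.
apply: eq_big => k; rewrite subSS.
  have kn : (k <= n)%N by rewrite -ltnS.
  by rewrite subKn// subr_lt0 -natrM ltr_nat mul2n doubleB; congr (_ && _); lia.
by move=> _; rewrite cw_atom_rev// -ltnS.
Qed.

End Final.

(** * Both phases *)

Lemma sixth_root (R : realType) (n : nat) (a := n%:R `^ (6%:R^-1) : R) :
  (0 < n)%N -> [/\ 1 <= a, a ^+ 6 = n%:R & a ^+ 3 = Num.sqrt n%:R].
Proof.
move=> n0; have n1 : 1 <= n%:R :> R by rewrite ler1n.
have a0 : 0 <= a by exact: powR_ge0.
have a6 : a ^+ 6 = n%:R.
  by rewrite -powR_mulrn// /a -powRrM mulVf ?powRr1// ?ler0n// pnatr_eq0.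
split=> //.
  by rewrite leNgt; apply/negP => a1; move: n1; rewrite -a6 leNgt exprn_ilt1.
by rewrite -a6 (_ : 6 = 3 * 2)%N// exprM sqrtr_sqr ger0_norm// exprn_ge0.
Qed.

Lemma site_opp (R : realType) (b m : R) n k : (k <= n)%N ->
  (2 * (n - k)%:R - n%:R - n%:R * m) / cw_sigma b n m = - site b (- m) n k.
Proof.
move=> kn; rewrite /site.
have -> : cw_sigma b n (- m) = cw_sigma b n m by rewrite /cw_sigma sqrrN.
rewrite -[RHS]mulNr natrB//; congr (_ * _); ring.
Qed.

Theorem proposition4p4 (R : realType) (beta : R) (hbeta : 1 < beta)
    (m1 m2 : R) (hm1 : m1 < 0) (hm2 : 0 < m2)
    (hm1_root : m1 = tanh (beta * m1)) (hm2_root : m2 = tanh (beta * m2)) :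
  exists C : R,
    forall (n : nat) (d : measure_display) (T : measurableType d)
      (P : probability T R) (Sigma : 'I_n -> {RV P >-> R}) (x : R),
      (0 < n)%N ->
      curie_weiss_distributed beta 0 Sigma ->
      0 <= x -> x <= n%:R `^ (6%:R^-1) ->
      `| cond_prob P [set w | x <= cw_W beta Sigma m1 w]
                     [set w | total_spin Sigma w < 0]
           / (1 - std_normal_cdf x) - 1 |
        <= C * ((1 + x ^+ 3) / Num.sqrt n%:R)
      /\
      `| cond_prob P [set w | x <= cw_W beta Sigma m2 w]
                     [set w | 0 < total_spin Sigma w]
           / (1 - std_normal_cdf x) - 1 |
        <= C * ((1 + x ^+ 3) / Num.sqrt n%:R).
Proof.
have b0 : 0 < beta by lra.
have m0 : 0 < - m1 by rewrite oppr_gt0.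
have mE : - m1 = tanh (beta * - m1).
  rewrite [in LHS]hm1_root /tanh mulrN opprK.
  move: (expR (beta * m1)) (expR (- (beta * m1))) => p q.
  by rewrite (addrC q p); ring.
have [C1 tail1] := root_tails beta (- m1) b0 m0 mE.
have [C2 tail2] := root_tails beta m2 b0 hm2 hm2_root.
exists (Num.max C1 C2) => n d T P Sigma x n0 law x0 xa.
have [a1 a6 a3] := @sixth_root R n n0; rewrite -a3.
have eta0 : 0 <= (1 + x ^+ 3) / (n%:R `^ (6%:R^-1)) ^+ 3.
  by rewrite divr_ge0 ?addr_ge0 ?exprn_ge0// (le_trans ler01).
split.
- have [_ h] := tail1 n _ x n0 a1 a6 x0 xa.
  have -> : cond_prob P [set w | x <= cw_W beta Sigma m1 w]
                        [set w | total_spin Sigma w < 0] =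
    positive_weight beta n (fun k => site beta (- m1) n k <= - x) /
      positive_weight beta n xpredT.
    have := cond_prob_total_spin P beta n Sigma n0 law
      (fun r => x <= (r - n%:R * m1) / cw_sigma beta n m1) (fun r => r < 0).
    rewrite /= => ->; congr (_ / _).
      rewrite (negative_weightE beta n
        (fun k => x <= (2 * k%:R - n%:R - n%:R * m1) / cw_sigma beta n m1)).
      apply: eq_bigl => k; congr (_ && _).
      by rewrite lerNr site_opp// -ltnS.
    rewrite -(negative_weightE beta n xpredT).
    by apply: eq_bigl => k; rewrite andbT.
  by apply: (le_trans h); rewrite ler_wpM2r// le_max lexx.
- have [h _] := tail2 n _ x n0 a1 a6 x0 xa.
  have -> : cond_prob P [set w | x <= cw_W beta Sigma m2 w]
                        [set w | 0 < total_spin Sigma w] =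
    positive_weight beta n (fun k => x <= site beta m2 n k) /
      positive_weight beta n xpredT.
    have := cond_prob_total_spin P beta n Sigma n0 law
      (fun r => x <= (r - n%:R * m2) / cw_sigma beta n m2) (fun r => 0 < r).
    rewrite /= => ->; congr (_ / _); first exact: positive_weightE.
    rewrite -(positive_weightE beta n xpredT).
    by apply: eq_bigl => k; rewrite andbT.
  by apply: (le_trans h); rewrite ler_wpM2r// le_max lexx orbT.
Qed.
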